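(* Let $\mathcal{G}$ be a Fréchet Lie group, let $\mathcal{P}$ be a Fréchet principal $\mathcal{G}$-bundle over a Fréchet manifold $\mathcal{M}$, and consider a smooth representation of $\mathcal{G}$ on a rigged Hilbert space $E$. Then the associated bundle $(\mathcal{P}\times E)/\mathcal{G}$, together with the Hermitian metric $g([p,v],[p,w]):=\langle v,w\rangle_E$, is a rigged Hilbert space bundle over $\mathcal{M}$ with fibre $E$.
   Context: A rigged Hilbert space is a Fréchet space with a continuous sesquilinear inner product; a morphism is a continuous linear map, isometric if it preserves inner products. A smooth representation of $\mathcal{G}$ on $E$ is an action by isometric morphisms such that $\mathcal{G}\times E\to E$ is smooth. A rigged Hilbert space bundle over $\mathcal{M}$ with fibre $E$ is a Fréchet vector bundle $\mathcal{E}\to\mathcal{M}$ with fibre $E$ together with a map $g:\mathcal{E}\times_{\mathcal{M}}\mathcal{E}\to\mathbb{C}$ (Hermitian metric) such that $g_x$ is an inner product on $\mathcal{E}_x$ for each $x\in\mathcal{M}$, and each $x\in\mathcal{M}$ has an open neighbourhood $U$ with a diffeomorphism $\mathcal{E}|_U\to U\times E$ that is fibre-preserving, fibrewise linear and fibrewise an isometry. A Fréchet principal $\mathcal{G}$-bundle is a Fréchet manifold $\mathcal{P}$ with a smooth surjection to $\mathcal{M}$ and a fibre-preserving right $\mathcal{G}$-action, admitting local $\mathcal{G}$-equivariant fibre-preserving diffeomorphisms $\mathcal{P}|_U\to U\times\mathcal{G}$. In $(\mathcal{P}\times E)/\mathcal{G}$, the group acts by $(p,v)g=(pg,g^{-1}v)$;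 the quotient carries the unique Fréchet manifold structure for which $\mathcal{P}\times E\to(\mathcal{P}\times E)/\mathcal{G}$ is a surjective submersion, and the fibrewise vector space structure $[p,v]+[p,w]=[p,v+w]$, $\lambda[p,v]=[p,\lambda v]$. *)

(* Defs.v *)
From HB Require Import structures.
From mathcomp Require Import all_boot all_order all_algebra.
From mathcomp Require Import complex generic_quotient.
From mathcomp Require Import all_classical all_reals all_analysis.

Set Implicit Arguments.
Unset Strict Implicit.
Unset Printing Implicit Defensive.

Import Order.TTheory GRing.Theory Num.Theory.
Import numFieldTopology.Exports numFieldNormedType.Exports.

Local Open Scope classical_set_scope.
Local Open Scope ring_scope.

Section ProdTopology.
Variables X Y : topologicalType.

Lemma nbhsX (x : X) (y : Y) A B :
  nbhs x A -> nbhs y B -> nbhs (x, y) (A `*` B).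
Proof. by move=> nA nB; exists (A, B). Qed.

Lemma open_setX (A : set X) (B : set Y) : open A -> open B -> open (A `*` B).
Proof.
move=> oA oB; rewrite openE => -[x y] [/= Ax By].
by apply: nbhsX; exact: open_nbhs_nbhs.
Qed.

Lemma prod_hausdorff :
  hausdorff_space X -> hausdorff_space Y -> hausdorff_space (X * Y)%type.
Proof.
move=> hX hY [a b] [c d] h; congr pair.
  apply: hX => A B nA nB.
  have [[x y] [/= [Ax _] [Bx _]]] :=
    h _ _ (nbhsX nA (@filterT _ (nbhs b) _)) (nbhsX nB (@filterT _ (nbhs d) _)).
  by exists x.
apply: hY => A B nA nB.
have [[x y] [/= [_ Ay] [_ By]]] :=
  h _ _ (nbhsX (@filterT _ (nbhs a) _) nA) (nbhsX (@filterT _ (nbhs c) _) nB).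
by exists y.
Qed.

Lemma continuous_prod (X' Y' : topologicalType) (A : set X) (B : set Y)
    (f : X -> X') (g : Y -> Y') :
  {in A, continuous f} -> {in B, continuous g} ->
  {in A `*` B, continuous (fun x : X * Y => (f x.1, g x.2))}.
Proof.
move=> fc gc x; rewrite in_setX => /andP[Ax Bx]; apply: cvg_pair => /=.
  by apply: (continuous_comp (f := fst)); [exact: cvg_fst|exact: fc].
by apply: (continuous_comp (f := snd)); [exact: cvg_snd|exact: gc].
Qed.

End ProdTopology.

Definition seminorm (K : numFieldType) (V : lmodType K) (p : V -> K) : Prop :=
  [/\ forall x, 0 <= p x,
      forall x y, p (x + y) <= p x + p y &
      forall a x, p (a *: x) = `|a| * p x].

(* Cauchy filters for the additive uniformity: [tvsType] also carries a
   uniform structure, which need not be the translation-invariant one. *)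
Definition tvs_cauchy (K : numFieldType) (V : tvsType K) (F : set_system V) :=
  forall U, nbhs (0 : V) U ->
    exists2 A, F A & forall x y, A x -> A y -> U (x - y).

HB.mixin Record Tvs_isFrechet (K : numFieldType) V of Tvs K V := {
  frechet_seminorms : exists2 p : nat -> V -> K,
    forall n, seminorm (p n) &
    forall U, nbhs (0 : V) U <->
      exists n e, 0 < e /\ [set x | forall i, (i <= n)%N -> p i x < e] `<=` U;
  frechet_hausdorff : hausdorff_space V;
  frechet_complete : forall F : set_system V,
    ProperFilter F -> tvs_cauchy F -> exists x : V, F --> x }.

#[short(type="frechetType")]
HB.structure Definition Frechet (K : numFieldType) :=
  {V of Tvs_isFrechet K V & Tvs K V}.

Section ProdFrechet.
Variables (K : numFieldType) (V W : frechetType K).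

Let prod_seminorms : exists2 p : nat -> V * W -> K,
  forall n, seminorm (p n) &
  forall U, nbhs (0 : V * W) U <->
    exists n e, 0 < e /\ [set x | forall i, (i <= n)%N -> p i x < e] `<=` U.
Proof.
have [p ps pU] := @frechet_seminorms K V.
have [q qs qU] := @frechet_seminorms K W.
exists (fun n x => p n x.1 + q n x.2).
  move=> n; have [p0 pD pZ] := ps n; have [q0 qD qZ] := qs n; split.
  - by move=> x; rewrite addr_ge0.
  - by move=> x y; rewrite addrACA lerD ?pD ?qD.
  - by move=> a x; rewrite pZ qZ mulrDr.
move=> U; split.
  move=> [[A B] /= [/pU [n [e [e0 nA]]] /qU [m [d [d0 mB]]]] AB].
  have ed0 : 0 < e + d by rewrite addr_gt0.
  pose c := e * d / (e + d).
  have c0 : 0 < c by rewrite divr_gt0 ?mulr_gt0.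
  have ce : c <= e by rewrite ler_pdivrMr// ler_pM2l// lerDr ltW.
  have cd : c <= d by rewrite ler_pdivrMr// mulrC ler_pM2l// lerDl ltW.
  exists (maxn n m), c; split=> // -[x y] /= h.
  apply: AB; split => /=.
    apply: nA => i ni /=; apply: lt_le_trans ce.
    apply: le_lt_trans (h i _); last by rewrite (leq_trans ni) ?leq_maxl.
    by rewrite lerDl; have [] := qs i.
  apply: mB => i ni /=; apply: lt_le_trans cd.
  apply: le_lt_trans (h i _); last by rewrite (leq_trans ni) ?leq_maxr.
  by rewrite lerDr; have [] := ps i.
move=> [n [e [e0 nU]]].
have e2 : 0 < e / 2 by rewrite divr_gt0.
exists ([set x | forall i, (i <= n)%N -> p i x < e / 2],
        [set x | forall i, (i <= n)%N -> q i x < e / 2]).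
  by split; [apply/pU|apply/qU]; exists n, (e / 2); split.
move=> [x y] /= [px qy]; apply: nU => i ni /=.
by rewrite [e]splitr ltrD ?px ?qy.
Qed.

Let prod_complete (F : set_system (V * W)) :
  ProperFilter F -> tvs_cauchy F -> exists x : V * W, F --> x.
Proof.
move=> FF Fc.
have Fc1 : tvs_cauchy (fst @ F : set_system V).
  move=> U nU; have [A FA AU] := Fc _ (nbhsX nU (@filterT _ (nbhs 0) _)).
  exists (fst @` A : set V).
    by apply: (@filterS _ F _ A (fst @^-1` _)) => // z Az; exists z.
  by move=> _ _ [z Az <-] [w Aw <-]; have [] := AU _ _ Az Aw.
have Fc2 : tvs_cauchy (snd @ F : set_system W).
  move=> U nU; have [A FA AU] := Fc _ (nbhsX (@filterT _ (nbhs 0) _) nU).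
  exists (snd @` A : set W).
    by apply: (@filterS _ F _ A (snd @^-1` _)) => // z Az; exists z.
  by move=> _ _ [z Az <-] [w Aw <-]; have [] := AU _ _ Az Aw.
have [x Fx] := @frechet_complete K V _ (fmap_proper_filter _ FF) Fc1.
have [y Fy] := @frechet_complete K W _ (fmap_proper_filter _ FF) Fc2.
exists (x, y) => U [[A B] /= [nA nB] AB].
apply: (@filterS _ F _ ((fst @^-1` A) `&` (snd @^-1` B))).
  by move=> [z w] zw; exact: AB.
by apply: (@filterI _ F); [exact: (Fx _ nA)|exact: (Fy _ nB)].
Qed.

HB.instance Definition _ := Tvs_isFrechet.Build K (V * W)%type
  prod_seminorms
  (prod_hausdorff (@frechet_hausdorff _ V) (@frechet_hausdorff _ W))
  prod_complete.

End ProdFrechet.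

(* A complex Frechet space regarded as a real one. *)
Definition realify (E : Type) : Type := E.

Section Realify.
Variables (R : realType) (E : frechetType R[i]).

HB.instance Definition _ := Uniform.copy (realify E) E.
HB.instance Definition _ := TopologicalZmodule.copy (realify E) E.

Let scalec (a : R) (x : realify E) : realify E := (a%:C)%C *: (x : E).

Let scalecA a b v : scalec a (scalec b v) = scalec (a * b) v.
Proof. by rewrite /scalec scalerA rmorphM. Qed.
Let scale1c : left_id 1 scalec.
Proof. by move=> v; rewrite /scalec rmorph1 scale1r. Qed.
Let scalecDr : right_distributive scalec +%R.
Proof. by move=> a u v; rewrite /scalec scalerDr. Qed.
Let scalecDl v : {morph scalec^~ v : a b / a + b}.
Proof. by move=> a b; rewrite /scalec rmorphD scalerDl. Qed.

HB.instance Definition _ := GRing.Zmodule_isLmodule.Build R (realify E)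
  scalecA scale1c scalecDr scalecDl.

Let normC (a : R) : `|(a%:C)%C| = (`|a|%:C)%C :> R[i].
Proof. by rewrite normc_def/= expr0n/= addr0 sqrtr_sqr. Qed.

Let continuousC : continuous (fun a : R^o => (a%:C)%C : R[i]^o).
Proof.
move=> a; apply/cvgrPdist_lt => e e0.
have er : e = ((complex.Re e)%:C)%C by rewrite RRe_real// gtr0_real.
have e0' : 0 < complex.Re e by rewrite -ltcR -er.
near=> b; rewrite /= -rmorphB normC er ltcR.
by near: b; exact: (@cvgr_dist_lt _ R^o _ _ _ id a).
Unshelve. all: by end_near. Qed.

Let realify_scale_continuous :
  continuous (fun z : R^o * realify E => z.1 *: z.2).
Proof.
move=> [a x] U /= /(@scale_continuous _ E ((a%:C)%C, x))[[A B] /= [nA nB] AB].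
exists ((fun a : R^o => (a%:C)%C : R[i]^o) @^-1` A, B) => /=.
  by split=> //; exact: continuousC.
by move=> [b y] /= [Ab By]; exact: (AB ((b%:C)%C, y)).
Qed.

HB.instance Definition _ := TopologicalNmodule_isTopologicalLmodule.Build R
  (realify E) realify_scale_continuous.

Let realify_locally_convex : exists2 B : set_system (realify E),
  (forall b, b \in B -> convex_set b) & basis B.
Proof.
have [B Bc Bb] := @locally_convex _ E.
exists B => // b bB x y l xb yb.
have l0 : 0 <= (l%:num%:C)%C :> R[i] by rewrite lecR.
have l1 : (l%:num%:C)%C <= 1 :> R[i] by rewrite -[1]/((1%:C)%C) lecR.
have := Bc b bB x y (Itv01 l0 l1) xb yb.
by congr (_ \in b); rewrite /conv/= /GRing.scale/= /scalec rmorphB.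
Qed.

HB.instance Definition _ := Uniform_isTvs.Build R (realify E)
  realify_locally_convex.

Let realify_seminorms : exists2 p : nat -> realify E -> R,
  forall n, seminorm (p n) &
  forall U, nbhs (0 : realify E) U <->
    exists n e, 0 < e /\ [set x | forall i, (i <= n)%N -> p i x < e] `<=` U.
Proof.
have [p ps pU] := @frechet_seminorms _ E.
have pE n x : ((complex.Re (p n x))%:C)%C = p n x.
  by rewrite RRe_real// ger0_real//; have [] := ps n.
exists (fun n x => complex.Re (p n x)).
  move=> n; have [p0 pD pZ] := ps n; split.
  - by move=> x; rewrite -lecR pE.
  - by move=> x y; rewrite -lecR rmorphD /= !pE.
  - by move=> a x; apply: complexI; rewrite rmorphM/= !pE -normC -pZ.
move=> U; split=> [/pU[n [e [e0 nU]]]|[n [e [e0 nU]]]]; last first.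
  apply/pU; exists n, (e%:C)%C; split; first by rewrite ltcR.
  by move=> x /= h; apply: nU => i /h; rewrite -pE ltcR.
have er : e = ((complex.Re e)%:C)%C by rewrite RRe_real// gtr0_real.
exists n, (complex.Re e); split; first by rewrite -ltcR -er.
by move=> x h; apply: nU => i /h; rewrite -ltcR pE -er.
Qed.

HB.instance Definition _ := Tvs_isFrechet.Build R (realify E)
  realify_seminorms (@frechet_hausdorff _ E) (@frechet_complete _ E).

End Realify.

Section Smooth.
Variable R : realType.

(* Michal--Bastiani calculus: [f] is C^(k+1) on the open set [U] when its
   directional derivatives exist on [U] and form a C^k map on [U `*` setT]. *)
Fixpoint Ck (k : nat) (V W : frechetType R) (U : set V) (f : V -> W) : Prop :=
  {in U, continuous f} /\
  if k is k'.+1 then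
    exists2 df : V * V -> W,
      forall x v, U x ->
        (fun t : R => t^-1 *: (f (x + t *: v) - f x)) @ 0^' --> df (x, v) &
      Ck k' (U `*` setT) df
  else True.

Definition smooth_on (V W : frechetType R) (U : set V) (f : V -> W) : Prop :=
  forall k, Ck k U f.

Lemma Ck_linear k (V W : frechetType R) (f : {linear V -> W}) :
  continuous f -> Ck k setT f.
Proof.
elim: k V f => [|k IH] V f fc /=; first by split=> // x _; exact: fc.
split; first by move=> x _; exact: fc.
exists (f \o snd) => [x v _|].
  apply: cvg_near_cst; near=> t.
  rewrite /= [x + _]addrC linearP addrK scalerA mulVf ?scale1r//.
  by near: t; exact: nbhs_dnbhs_neq.
rewrite setXTT; apply: (IH _ (f \o snd : {linear _ -> _})).
by move=> x; apply: continuous_comp; [exact: cvg_snd|exact: fc].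
Unshelve. all: by end_near. Qed.

Lemma Ck_complin k (V V' W : frechetType R) (U : set V') (f : V' -> W)
    (l : {linear V -> V'}) :
  continuous l -> Ck k U f -> Ck k (l @^-1` U) (f \o l).
Proof.
elim: k V V' U f l => [|k IH] V V' U f l lc /=.
  move=> [fc _]; split=> // x; rewrite inE => Ux.
  by apply: continuous_comp; [exact: lc|apply: fc; rewrite inE].
move=> [fc [df fdf dfk]]; split.
  move=> x; rewrite inE => Ux.
  by apply: continuous_comp; [exact: lc|apply: fc; rewrite inE].
have ll : linear (fun x : V * V => (l x.1, l x.2)).
  by move=> a x y; rewrite /= !linearP.
pose LM := GRing.isLinear.Build R (V * V)%type (V' * V')%type *:%R _ ll.
pose L : {linear (V * V)%type -> (V' * V')%type} :=
  HB.pack (fun x : (V * V)%type => (l x.1, l x.2)) LM.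
exists (df \o L) => [x v Ux|].
  rewrite [X in X @ _ --> _](_ : _ =
    (fun t : R => t^-1 *: (f (l x + t *: l v) - f (l x)))).
    exact: fdf.
  by apply/funext => t; rewrite /= [x + _]addrC linearP [_ + l x]addrC.
rewrite (_ : _ `*` setT = L @^-1` (U `*` setT)) //.
apply: IH dfk => x; apply: cvg_pair => /=.
  by apply: (continuous_comp (f := fst)); [exact: cvg_fst|exact: lc].
by apply: (continuous_comp (f := snd)); [exact: cvg_snd|exact: lc].
Qed.

Lemma Ck_prod k (V W V' W' : frechetType R) (U : set V) (U' : set V')
    (f : V -> W) (f' : V' -> W') :
  Ck k U f -> Ck k U' f' ->
  Ck k (U `*` U') (fun x : V * V' => (f x.1, f' x.2)).
Proof.
elim: k V V' U U' f f' => [|k IH] V V' U U' f f' /=.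
  by move=> [fc _] [fc' _]; split=> //; exact: continuous_prod.
move=> [fc [df fdf dfk]] [fc' [df' fdf' dfk']].
split; first exact: continuous_prod.
pose s (z : (V * V') * (V * V')) : (V * V) * (V' * V') :=
  ((z.1.1, z.2.1), (z.1.2, z.2.2)).
have ls : linear s by move=> a x y.
pose SM := GRing.isLinear.Build R (V * V' * (V * V'))%type
  (V * V * (V' * V'))%type *:%R s ls.
pose S : {linear (V * V' * (V * V'))%type -> (V * V * (V' * V'))%type} :=
  HB.pack s SM.
exists ((fun z : (V * V) * (V' * V') => (df z.1, df' z.2)) \o S).
  move=> x v [Ux Ux']; apply: cvg_pair => /=; first exact: fdf.
  exact: fdf'.
rewrite (_ : _ `*` setT = S @^-1` ((U `*` setT) `*` (U' `*` setT))).
  apply: (@Ck_complin _ _ _ _ _ _ S _ (IH _ _ _ _ _ _ dfk dfk')).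
  have pc (X Y Z : topologicalType) (u : X -> Y) (w : X -> Z) :
      continuous u -> continuous w -> continuous (fun x => (u x, w x)).
    by move=> uc wc x; apply: cvg_pair; [exact: uc|exact: wc].
  have fc1 (X Y : topologicalType) : continuous (@fst X Y).
    by move=> x; exact: cvg_fst.
  have sc1 (X Y : topologicalType) : continuous (@snd X Y).
    by move=> x; exact: cvg_snd.
  by apply: (pc); apply: (pc) => x; apply: continuous_comp;
    solve [exact: fc1 | exact: sc1].
by apply/seteqP; split => [[[a b] [c d]] [[? ?] _]|[[a b] [c d]] [[? _] [? _]]].
Qed.

End Smooth.

Section Chart.
Variable R : realType.

(* [chart_map] is meaningful on [chart_dom] only, and [chart_inv] on its
   image. *)
Record chart (M : Type) (V : frechetType R) := Chart {
  chart_dom : set M;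
  chart_map :> M -> V;
  chart_inv : V -> M }.

Definition chart_img (M : Type) (V : frechetType R) (c : chart M V) : set V :=
  c @` chart_dom c.

Definition is_chart (M : topologicalType) (V : frechetType R) (c : chart M V) :=
  [/\ open (chart_dom c), open (chart_img c),
      {in chart_dom c, cancel c (chart_inv c)},
      {in chart_dom c, continuous c} &
      {in chart_img c, continuous (chart_inv c)}].

Definition chart_compatible (M : Type) (V W : frechetType R)
    (c : chart M V) (d : chart M W) : Prop :=
  smooth_on (c @` (chart_dom c `&` chart_dom d)) (d \o chart_inv c) /\
  smooth_on (d @` (chart_dom c `&` chart_dom d)) (c \o chart_inv d).

End Chart.

(* The model space may vary from chart to chart; [atlas] need not be maximal. *)
HB.mixin Record Topological_isFrechetManifold (R : realType) M
    of Topological M := {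
  atlas : forall V : frechetType R, set (chart M V);
  manifold_hausdorff : hausdorff_space M;
  atlas_chart : forall V (c : chart M V), atlas V c -> is_chart c;
  atlas_cover : forall x : M,
    exists (V : frechetType R) (c : chart M V), atlas V c /\ chart_dom c x;
  atlas_compatible : forall V W (c : chart M V) (d : chart M W),
    atlas V c -> atlas W d -> chart_compatible c d }.

#[short(type="frechetManifoldType")]
HB.structure Definition FrechetManifold (R : realType) :=
  {M of Topological_isFrechetManifold R M & Topological M}.

Definition frechet_structure (R : realType) (T : Type) : Type :=
  FrechetManifold.axioms_ R T.

Definition with_structure (R : realType) (T : Type)
    (X : frechet_structure R T) : frechetManifoldType R :=
  FrechetManifold.Pack X.

Inductive prod_atlas (R : realType) (M N : frechetManifoldType R) :
    forall V : frechetType R, chart (M * N)%type V -> Prop :=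
  ProdAtlas (V W : frechetType R) (c : chart M V) (d : chart N W) of
    atlas V c & atlas W d :
    @prod_atlas R M N (V * W)%type
      (Chart (chart_dom c `*` chart_dom d)
             (fun x => (c x.1, d x.2) : V * W)
             (fun v => (chart_inv c v.1, chart_inv d v.2))).

Section ProdManifold.
Variables (R : realType) (M N : frechetManifoldType R).

Let prod_atlasP (V : frechetType R) (e : chart (M * N)%type V) :
  @prod_atlas R M N V e -> is_chart e.
Proof.
case=> {V e} V W c d /atlas_chart[c1 c2 c3 c4 c5] /atlas_chart[d1 d2 d3 d4 d5].
have imgE : (fun x => (c x.1, d x.2) : V * W) @` (chart_dom c `*` chart_dom d)
    = chart_img c `*` chart_img d.
  apply/seteqP; split=> [_ [[x y] [/= cx dy] <-]|].
    by split; [exists x|exists y].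
  by move=> [_ _] /= [[x cx <-] [y dy <-]]; exists (x, y).
split; rewrite /chart_img /= ?imgE.
- exact: open_setX.
- exact: open_setX.
- by move=> [x y]; rewrite in_setX/= => /andP[/c3 -> /d3 ->].
- exact: continuous_prod.
- exact: continuous_prod.
Qed.

Let prod_cover (x : M * N) : exists (V : frechetType R) (c : chart (M * N)%type V),
  @prod_atlas R M N V c /\ chart_dom c x.
Proof.
have [V [c [Ac cx]]] := @atlas_cover R M x.1.
have [W [d [Ad dx]]] := @atlas_cover R N x.2.
by exists (V * W)%type; eexists; split; [exact: (ProdAtlas Ac Ad)|].
Qed.

Let prod_compatible (V W : frechetType R) (c : chart (M * N)%type V)
    (d : chart (M * N)%type W) :
  @prod_atlas R M N V c -> @prod_atlas R M N W d -> chart_compatible c d.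
Proof.
have imgE (X X' Y Y' : Type) (f : X -> Y) (f' : X' -> Y') A A' B B' :
    (fun x => (f x.1, f' x.2)) @` ((A `*` A') `&` (B `*` B')) =
    (f @` (A `&` B)) `*` (f' @` (A' `&` B')).
  apply/seteqP; split=> [_ [[x y] [[/= ? ?] [/= ? ?]] <-]|].
    by split; [exists x|exists y].
  by move=> [_ _] /= [[x [? ?] <-] [y [? ?] <-]]; exists (x, y).
case=> {V c} V V' c c' Ac Ac'; case=> {W d} W W' d d' Ad Ad'.
have [p q] := @atlas_compatible _ _ _ _ _ _ Ac Ad.
have [p' q'] := @atlas_compatible _ _ _ _ _ _ Ac' Ad'.
by split=> k; rewrite /= imgE; [exact: (Ck_prod (p k) (p' k))|exact: (Ck_prod (q k) (q' k))].
Qed.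

HB.instance Definition _ := Topological_isFrechetManifold.Build R (M * N)%type
  (prod_hausdorff (@manifold_hausdorff R M) (@manifold_hausdorff R N))
  prod_atlasP prod_cover prod_compatible.

End ProdManifold.

Inductive model_atlas (R : realType) (E : frechetType R) :
    forall V : frechetType R, chart E V -> Prop :=
  ModelAtlas : @model_atlas R E E (Chart setT id id).

Section ModelManifold.
Variables (R : realType) (E : frechetType R[i]).

Let model_atlasP (V : frechetType R) (c : chart (realify E) V) :
  @model_atlas R (realify E) V c -> is_chart c.
Proof.
case=> {V c}; rewrite /is_chart /chart_img /= image_id.
by split=> //; try exact: openT; move=> x _; exact: cvg_id.
Qed.

Let model_cover (x : realify E) : exists (V : frechetType R)
  (c : chart (realify E) V), @model_atlas R (realify E) V c /\ chart_dom c x.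
Proof. by exists (realify E); eexists; split; [exact: ModelAtlas|]. Qed.

Let model_compatible (V W : frechetType R) (c : chart (realify E) V)
    (d : chart (realify E) W) :
  @model_atlas R (realify E) V c -> @model_atlas R (realify E) W d ->
  chart_compatible c d.
Proof.
have h : smooth_on setT (@id (realify E)).
  by move=> k; apply: (@Ck_linear _ _ _ _ idfun) => x; exact: cvg_id.
by case=> {V c}; case=> {W d}; rewrite /chart_compatible/= setTI image_id.
Qed.

HB.instance Definition _ := Topological_isFrechetManifold.Build R (realify E)
  (@frechet_hausdorff _ E) model_atlasP model_cover model_compatible.

End ModelManifold.

Section SmoothMaps.
Variables (R : realType).

(* For open [U] and [{in U, continuous f}], the set on which the local
   representative is required to be smooth is open. *)
Definition smooth_map_on (M N : frechetManifoldType R) (U : set M) (f : M -> N)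
    : Prop :=
  {in U, continuous f} /\
  forall (V W : frechetType R) (c : chart M V) (d : chart N W),
    atlas V c -> atlas W d ->
    smooth_on (c @` (U `&` chart_dom c `&` f @^-1` chart_dom d))
              (d \o f \o chart_inv c).

Definition smooth_map (M N : frechetManifoldType R) (f : M -> N) : Prop :=
  smooth_map_on setT f.

Definition same_structure (T : Type)
    (X Y : frechet_structure R T) : Prop :=
  @smooth_map (with_structure X) (with_structure Y) id /\
  @smooth_map (with_structure Y) (with_structure X) id.

Definition diffeo_on (M N : frechetManifoldType R) (U : set M) (U' : set N)
    (f : M -> N) (g : N -> M) : Prop :=
  [/\ open U, open U', f @` U `<=` U', g @` U' `<=` U &
   [/\ {in U, cancel f g}, {in U', cancel g f}, smooth_map_on U f &
       smooth_map_on U' g]].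

Definition in_maximal_atlas (M : frechetManifoldType R) (V : frechetType R)
    (c : chart M V) : Prop :=
  is_chart c /\ forall W (d : chart M W), atlas W d -> chart_compatible c d.

(* In suitable charts the map is the projection onto a factor. *)
Definition submersion (M N : frechetManifoldType R) (f : M -> N) : Prop :=
  smooth_map f /\
  forall x : M, exists (V W : frechetType R) (c : chart M (V * W)%type)
      (d : chart N V),
    [/\ in_maximal_atlas c, in_maximal_atlas d, chart_dom c x,
        f @` chart_dom c `<=` chart_dom d &
        forall y, chart_dom c y -> d (f y) = (c y).1].

End SmoothMaps.

HB.mixin Record FrechetManifold_isLieGroup (R : realType) G
    of FrechetManifold R G & Group G := {
  mul_smooth : smooth_map (fun p : G * G => (p.1 * p.2)%g);
  inv_smooth : smooth_map (fun g : G => g^-1%g) }.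

#[short(type="frechetLieGroupType")]
HB.structure Definition FrechetLieGroup (R : realType) :=
  {G of FrechetManifold_isLieGroup R G & FrechetManifold R G & Group G}.

Record principalBundle (R : realType) (G : frechetLieGroupType R)
    (M P : frechetManifoldType R) := PrincipalBundle {
  pb_proj : P -> M;
  pb_act : P -> G -> P;
  pb_proj_smooth : smooth_map pb_proj;
  pb_proj_surj : forall x, exists p, pb_proj p = x;
  pb_act1 : forall p, pb_act p 1%g = p;
  pb_actM : forall p g h, pb_act p (g * h)%g = pb_act (pb_act p g) h;
  pb_proj_act : forall p g, pb_proj (pb_act p g) = pb_proj p;
  pb_trivial : forall x, exists (U : set M) (Phi : P -> M * G)
      (Psi : M * G -> P),
    [/\ open U, U x, diffeo_on (pb_proj @^-1` U) (U `*` setT) Phi Psi,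
        forall p, U (pb_proj p) -> (Phi p).1 = pb_proj p &
        forall p g, U (pb_proj p) ->
          Phi (pb_act p g) = ((Phi p).1, ((Phi p).2 * g)%g)] }.

(* The inner product is linear in its first argument. *)
Record riggedHilbertType (R : realType) := RiggedHilbert {
  rh_space :> frechetType R[i];
  rh_inner : {dot rh_space for Num.conj};
  rh_inner_continuous :
    continuous (fun x : rh_space * rh_space => rh_inner x.1 x.2 : R[i]^o) }.

Record isometric_morphism (R : realType) (E F : riggedHilbertType R)
    (f : E -> F) : Prop := IsometricMorphism {
  im_linear : linear f;
  im_continuous : continuous f;
  im_isometric : forall v w, rh_inner F (f v) (f w) = rh_inner E v w }.

Record smoothRepresentation (R : realType) (G : frechetLieGroupType R)
    (E : riggedHilbertType R) := SmoothRepresentation {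
  rep :> G -> E -> E;
  rep_morphism : forall g, isometric_morphism (rep g);
  rep1 : forall v, rep 1%g v = v;
  repM : forall g h v, rep (g * h)%g v = rep g (rep h v);
  rep_smooth :
    smooth_map (fun x : G * realify E => rep x.1 x.2 : realify E) }.

Definition bundle_trivialization (R : realType) (E : frechetType R[i])
    (M T : frechetManifoldType R) (proj : T -> M) (add : T -> T -> T)
    (scale : R[i] -> T -> T) (U : set M) (Phi : T -> M * realify E)
    (Psi : M * realify E -> T) : Prop :=
  [/\ open U, diffeo_on (proj @^-1` U) (U `*` setT) Phi Psi,
      forall e, U (proj e) -> (Phi e).1 = proj e,
      forall e f, U (proj e) -> proj e = proj f ->
        (Phi (add e f)).2 = ((Phi e).2 : E) + ((Phi f).2 : E) &
      forall a e, U (proj e) -> (Phi (scale a e)).2 = a *: ((Phi e).2 : E)].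

(* The vector space structure of the fibres is given by a zero section and by
   operations on the total space; [vb_add e f] is meaningful only when [e] and
   [f] lie in the same fibre. *)
Record vectorBundle (R : realType) (E : frechetType R[i])
    (M T : frechetManifoldType R) := VectorBundle {
  vb_proj : T -> M;
  vb_zero : M -> T;
  vb_add : T -> T -> T;
  vb_scale : R[i] -> T -> T;
  vb_proj_smooth : smooth_map vb_proj;
  vb_proj_zero : forall x, vb_proj (vb_zero x) = x;
  vb_proj_add : forall e f,
    vb_proj e = vb_proj f -> vb_proj (vb_add e f) = vb_proj e;
  vb_proj_scale : forall a e, vb_proj (vb_scale a e) = vb_proj e;
  vb_addA : forall e f h, vb_proj e = vb_proj f -> vb_proj f = vb_proj h ->
    vb_add e (vb_add f h) = vb_add (vb_add e f) h;
  vb_addC : forall e f, vb_proj e = vb_proj f -> vb_add e f = vb_add f e;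
  vb_add0 : forall e, vb_add (vb_zero (vb_proj e)) e = e;
  vb_addN : forall e, vb_add (vb_scale (-1) e) e = vb_zero (vb_proj e);
  vb_scale1 : forall e, vb_scale 1 e = e;
  vb_scaleA : forall a b e, vb_scale a (vb_scale b e) = vb_scale (a * b) e;
  vb_scaleDr : forall a e f, vb_proj e = vb_proj f ->
    vb_scale a (vb_add e f) = vb_add (vb_scale a e) (vb_scale a f);
  vb_scaleDl : forall a b e,
    vb_scale (a + b) e = vb_add (vb_scale a e) (vb_scale b e);
  vb_trivial : forall x, exists (U : set M) (Phi : T -> M * realify E)
      (Psi : M * realify E -> T),
    U x /\ bundle_trivialization vb_proj vb_add vb_scale U Phi Psi }.

(* [rhb_metric e f] is meaningful only when [e] and [f] lie in the same
   fibre. *)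
Record riggedHilbertBundle (R : realType) (E : riggedHilbertType R)
    (M T : frechetManifoldType R) := RiggedHilbertBundle {
  rhb_bundle :> vectorBundle E M T;
  rhb_metric : T -> T -> R[i];
  rhb_metric_linear : forall a e f h,
    vb_proj rhb_bundle e = vb_proj rhb_bundle f ->
    vb_proj rhb_bundle f = vb_proj rhb_bundle h ->
    rhb_metric (vb_add rhb_bundle (vb_scale rhb_bundle a e) f) h =
    a * rhb_metric e h + rhb_metric f h;
  rhb_metric_herm : forall e f, vb_proj rhb_bundle e = vb_proj rhb_bundle f ->
    rhb_metric e f = Num.conj (rhb_metric f e);
  rhb_metric_gt0 : forall e, e <> vb_zero rhb_bundle (vb_proj rhb_bundle e) ->
    0 < rhb_metric e e;
  rhb_trivial : forall x, exists (U : set M) (Phi : T -> M * realify E)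
      (Psi : M * realify E -> T),
    [/\ U x, bundle_trivialization (vb_proj rhb_bundle) (vb_add rhb_bundle)
               (vb_scale rhb_bundle) U Phi Psi &
        forall e f, U (vb_proj rhb_bundle e) ->
          vb_proj rhb_bundle e = vb_proj rhb_bundle f ->
          rh_inner E (Phi e).2 (Phi f).2 = rhb_metric e f] }.

Section AssociatedBundle.
Variables (R : realType) (G : frechetLieGroupType R).
Variables (M P : frechetManifoldType R) (B : principalBundle G M P).
Variables (E : riggedHilbertType R) (rho : smoothRepresentation G E).

Definition assoc_rel : rel (P * realify E) := fun x y =>
  `[< exists g : G, y = (pb_act B x.1 g, rho (g^-1)%g x.2) >].

Lemma assoc_rel_refl : reflexive assoc_rel.
Proof.
move=> [p v]; apply/asboolP; exists 1%g.
by rewrite /= pb_act1 invg1 rep1.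
Qed.

Lemma assoc_rel_trans : transitive assoc_rel.
Proof.
move=> y x z /asboolP[g ->] /asboolP[h ->]; apply/asboolP; exists (g * h)%g.
by rewrite /= pb_actM invgM repM.
Qed.

Lemma assoc_rel_sym : symmetric assoc_rel.
Proof.
suff h x y : assoc_rel x y -> assoc_rel y x by move=> x y; apply/idP/idP; exact: h.
move=> /asboolP[g ->]; apply/asboolP; exists (g^-1)%g.
by rewrite /= -pb_actM -repM mulgV mulVg pb_act1 rep1; case: x.
Qed.

Canonical assoc_equiv :=
  EquivRel assoc_rel assoc_rel_refl assoc_rel_sym assoc_rel_trans.

(* The quotient (P * E) / G, as a bare set. *)
Definition assoc_bundle : Type := {eq_quot assoc_equiv}%qT.

Definition assoc_class (p : P) (v : E) : assoc_bundle :=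
  (\pi_{eq_quot assoc_equiv} (p, v))%qT.

(* The projection onto the quotient is surjective by construction. *)
Definition assoc_structure (X : frechet_structure R assoc_bundle) : Prop :=
  @submersion R (P * realify E)%type (with_structure X)
    (fun x => assoc_class x.1 x.2).

End AssociatedBundle.

(* Main.v *)
Require Import Defs.
From HB Require Import structures.
From mathcomp Require Import all_boot all_order all_algebra.
From mathcomp Require Import complex generic_quotient.
From mathcomp Require Import all_classical all_reals all_analysis.
Import Order.TTheory GRing.Theory Num.Theory.
Import numFieldTopology.Exports numFieldNormedType.Exports.
Set Implicit Arguments.
Unset Strict Implicit.
Unset Printing Implicit Defensive.
Local Open Scope classical_set_scope.
Local Open Scope ring_scope.

(** The bundle is locally a product. If [Phi] trivialises [P] over [U], then
    [[p, v] |-> (pb_proj p, (Phi p).2 v)] does not depend on the representative,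
    as [(Phi (p g)).2 = (Phi p).2 g] compensates the factor [g^-1] on [v]; its
    inverse is [(x, v) |-> [Psi (x, 1), v]]. Followed by charts of [M], these
    maps are charts of the quotient topology: two of them differ by the cocycle
    [(x, v) |-> (x, (Phi' (Psi (x, 1))).2 v)], which is smooth because the
    action of [G] on [E] is smooth as a map of two variables
    ([assoc_chart_transition_smooth]).

    In these charts the quotient map is [(x, g, v) |-> (x, g v)]. The change of
    coordinates [(x, g, v) |-> ((x, g v), g)] turns it into a projection, so it
    is a submersion ([assoc_pi_submersion]). A submersion has smooth sections
    near every point, hence a map out of its target is smooth as soon as its
    composite with the submersion is ([smooth_map_on_descend]). Applied to the
    identity this gives the uniqueness of the manifold structure
    ([submersion_same_structure]); applied to the trivialisations it gives their
    smoothness ([assoc_triv_diffeo]).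

    For the fibrewise operations a point of [P] is chosen above each point of
    [M], with no continuity; it identifies every fibre with [E]. Sum, multiples
    and inner product are those of [E]. As [G] acts by linear isometries, any
    other point of the same fibre of [P], in particular the one singled out by
    a local trivialisation, defines the same operations, whence both the
    formulas on classes and the compatibility with the trivialisations.

    All of this composes smooth maps, so it depends on the chain rule for
    Michal--Bastiani [C^k] maps ([Ck_comp]). Its analytic core is that a
    directional derivative that is jointly continuous is also the limit of
    difference quotients taken in directions that vary and converge
    ([dirderiv_cvg]); this follows from a mean value inequality for seminorms
    ([mean_value_seminorm]). *)

(** * Calculus of C^k maps between Frechet spaces *)

Section Calculus.
Variable R : realType.
Implicit Types V W : frechetType R.

(** Convergence is tested by one seminorm at a time, which is the form in which
    the mean value inequality can be used. *)
Lemma frechet_cvg_seminorm V : exists p : nat -> V -> R,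
  [/\ forall n, seminorm (p n),
      forall n (x : V) (e : R), 0 < e -> nbhs x [set z | p n (z - x) < e] &
      forall (F : set_system V), Filter F -> forall x : V,
        (forall n (e : R), 0 < e -> F [set z | p n (z - x) < e]) -> F --> x].
Proof.
have [p ps pU] := @frechet_seminorms R V.
exists p; split=> //.
- move=> n x e e0.
  have /(nbhsT x) : nbhs (0 : V) [set z | p n z < e].
    by apply/pU; exists n, e; split=> // z; apply.
  by apply: filterS => _ [z /= ze <-]; rewrite addrAC subrr add0r.
- move=> F FF x Fx A /(nbhsB (- x)); rewrite addNr => /pU[n [e [e0 nA]]].
  have : F [set z | forall i, (i <= n)%N -> p i (z - x) < e].
    elim: n {nA} => [|n IH].
      apply: filterS (Fx 0%N e e0) => z z0 i.
      by rewrite leqn0 => /eqP ->.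
    apply: filterS (filterI IH (Fx n.+1 e e0)) => z [/= zn zSn] i.
    by rewrite leq_eqVlt => /predU1P[->//|/zn].
  apply: filterS => z /nA[y Ay]; rewrite addrC => /addIr yz.
  by rewrite -yz.
Qed.

Lemma near_line V (x w : V) (A : set V) : nbhs x A ->
  exists T C, [/\ nbhs (0 : R) T, nbhs w C &
    forall t u, T t -> C u -> A (x + t *: u)].
Proof.
move=> nA; have nS : nbhs ((0 : R^o) *: w) [set y | A (x + y)].
  have := nbhsB (- x) nA; rewrite scale0r addNr.
  by apply: filterS => _ [y /= Ay <-]; rewrite /= addrA subrr add0r.
have [[T C] /= [nT nC] TC] := @scale_continuous _ V ((0 : R^o), w) _ nS.
by exists T, C; split=> // t u Tt Cu; exact: (TC (t, u)).
Qed.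

(** The supremum of the times [s] at which [p (g s - g 0) <= e * s] is attained,
    because the local estimate holds at it from the left, and equals [1],
    because the local estimate also carries it to the right. *)
Lemma mean_value_seminorm (V : lmodType R) (p : V -> R) (g : R -> V) (e : R) :
  seminorm p ->
  (forall s : R, 0 <= s <= 1 ->
    \forall r \near s, p (g r - g s) <= e * `|r - s|) ->
  p (g 1 - g 0) <= e.
Proof.
move=> [p0 pD pZ] gloc.
have pN x : p (- x) = p x by rewrite -scaleN1r pZ normrN1 mul1r.
have p00 : p 0 = 0 by rewrite -(scale0r 0) pZ normr0 mul0r.
pose S := [set s : R | 0 <= s <= 1 /\ p (g s - g 0) <= e * s].
have S0 : S 0 by split; rewrite ?lexx ?ler01// subrr p00 mulr0.
have Sub : has_ubound S by exists 1 => s [/andP[]].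
have supS : has_sup S by split; first by exists 0.
have s01 : 0 <= sup S <= 1.
  apply/andP; split; first exact: ub_le_sup.
  by apply: ge_sup; [exists 0|move=> s [/andP[]]].
have /nbhs_ballP[d /= d0 dS] := gloc _ s01.
have step (s t : R) : p (g s - g 0) <= e * s -> p (g t - g s) <= e * (t - s) ->
    p (g t - g 0) <= e * t.
  move=> hs ht.
  have -> : g t - g 0 = (g t - g s) + (g s - g 0) by rewrite addrA subrK.
  have -> : e * t = e * (t - s) + e * s by rewrite -mulrDr subrK.
  exact: le_trans (pD _ _) (lerD ht hs).
have [s [s01' hs] ss] := sup_adherent d0 supS.
have sle : s <= sup S by apply: ub_le_sup.
have Ssup : p (g (sup S) - g 0) <= e * sup S.
  apply: step hs _; rewrite -pN opprB.
  rewrite -[sup S - s]ger0_norm ?subr_ge0// distrC; apply: dS.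
  by rewrite /ball/= ger0_norm ?subr_ge0// ltrBlDr addrC -ltrBlDr.
have [S1|/eqP s1] := eqVneq (sup S) 1; first by move: Ssup; rewrite S1 mulr1.
exfalso.
pose t := Num.min 1 (sup S + d / 2).
have st : sup S < t.
  rewrite lt_min ltrDl divr_gt0// andbT lt_neqAle.
  by case/andP: s01 => _ ->; rewrite andbT; apply/eqP.
have : S t.
  split.
    by rewrite ge_min lexx/= andbT (le_trans _ (ltW st))//; case/andP: s01.
  apply: step Ssup _.
  rewrite -[t - _]ger0_norm; last by rewrite subr_ge0 ltW.
  apply: dS.
  rewrite /ball/= distrC ger0_norm ?subr_ge0 ?ltW//.
  rewrite ltrBlDr (@le_lt_trans _ _ (sup S + d / 2))//.
    by rewrite ge_min lexx orbT.
  by rewrite addrC ltrD2r ltr_pdivrMr// ltr_pMr// ltr1n.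
by move/(ub_le_sup Sub); rewrite leNgt st.
Qed.

(** At a fixed time [t] the curve [s |-> t^-1 f (y + s t w_t) - s df (y, w)] has
    derivative [df (y + s t w_t, w_t) - df (y, w)], which is small uniformly in
    [0 <= s <= 1] once [t] is small, by continuity of [df]. The mean value
    inequality bounds its increment, and this increment is the difference
    between the quotient and its limit. *)
Lemma dirderiv_cvg V W (U : set V) (f : V -> W) (df : V * V -> W) (y w : V)
    (w_ : R -> V) :
  open U -> U y ->
  (forall x v, U x ->
    (fun t : R => t^-1 *: (f (x + t *: v) - f x)) @ 0^' --> df (x, v)) ->
  df @ (y, w) --> df (y, w) -> w_ @ 0^' --> w ->
  (fun t : R => t^-1 *: (f (y + t *: w_ t) - f y)) @ 0^' --> df (y, w).
Proof.
move=> oU Uy fdf dfc ww.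
have [p [ps pn pF]] := frechet_cvg_seminorm W.
apply: pF => n e e0.
have e2 : 0 < e / 2 by rewrite divr_gt0.
have [[A B] /= [nA nB] AB] := dfc _ (pn n (df (y, w)) _ e2).
have nAU : nbhs y (A `&` U) by apply: filterI => //; exact: open_nbhs_nbhs.
have [T [C [nT nC TC]]] := near_line w nAU.
have [d /= d0 dT] := (nbhs_ballP (0 : R) T).1 nT.
have nBC := ww _ (filterI nB nC).
near=> t; have t0 : t != 0 by near: t; exact: nbhs_dnbhs_neq.
have td : `|t| < d.
  near: t; apply: nbhs_dnbhs; exists d => //= t /=.
  by rewrite sub0r normrN.
have [Bu Cu] : (B `&` C) (w_ t) by near: t; exact: nBC.
set u := w_ t in Bu Cu *.
have [pn0 pnD pnZ] := ps n.
(* the increment of g from 0 to 1 is the quotient at t minus df (y, w) *)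
pose g s := t^-1 *: f (y + (s * t) *: u) - s *: df (y, w).
suff : p n (g 1 - g 0) <= e / 2.
  rewrite /g mul1r scale1r mul0r !scale0r addr0 subr0 addrAC -scalerBr.
  by move=> /le_lt_trans; apply; rewrite ltr_pdivrMr// ltr_pMr// ltr1n.
apply: mean_value_seminorm => // s s01.
have [Aa Ua] : (A `&` U) (y + (s * t) *: u).
  apply: TC => //; apply: dT.
  rewrite /ball/= sub0r normrN normrM; apply: le_lt_trans td.
  by case/andP: s01 => s0 s1; rewrite ler_piMl// ger0_norm.
set a := y + (s * t) *: u in Aa Ua *.
(* the inequality at a is strict, and the slack absorbs the error of the
   difference quotient of f at a *)
have /= := AB (a, u) (conj Aa Bu); rewrite -subr_gt0 => dl0.
have /= [d' /= d'0 hd'] := fdf a u Ua _ (pn n (df (a, u)) _ dl0).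
apply/nbhs_ballP; exists (d' / `|t|) => /=.
  by rewrite divr_gt0 ?normr_gt0.
move=> r; rewrite /ball/= ltr_pdivlMr ?normr_gt0// -normrM => rs.
have [->|rns] := eqVneq r s.
  by rewrite !subrr normr0 mulr0 -(scale0r 0) pnZ normr0 mul0r.
have h0 : (r - s) * t != 0 by rewrite mulf_neq0// subr_eq0.
have hd : ball_ Num.norm 0 d' ((r - s) * t).
  by rewrite /ball_/= sub0r normrN -normrN -mulNr opprB.
have := hd' _ hd h0; rewrite /= => hh.
have -> : g r - g s = (r - s) *:
    (((r - s) * t)^-1 *: (f (a + ((r - s) * t) *: u) - f a) - df (y, w)).
  have -> : a + ((r - s) * t) *: u = y + (r * t) *: u.
    by rewrite /a -addrA -scalerDl -mulrDl subrKC.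
  rewrite scalerBr scalerA invfM mulrA divff ?subr_eq0// mul1r.
  rewrite /g -/a scalerBr scalerBl !opprB addrACA [RHS]addrACA.
  by rewrite [- (r *: _) - _]addrC.
rewrite pnZ mulrC ler_wpM2r// ltW//.
rewrite -(subrKA (df (a, u))) (le_lt_trans (pnD _ _))//.
by rewrite -ltrBrDr.
Unshelve. all: by end_near. Qed.

Lemma Ck_continuous k V W (U : set V) (f : V -> W) :
  Ck k U f -> {in U, continuous f}.
Proof. by case: k => [|k] []. Qed.

Lemma Ck_sub k V W (U A : set V) (f : V -> W) :
  A `<=` U -> Ck k U f -> Ck k A f.
Proof.
elim: k V U A f => [|k IH] V U A f AU [fc].
  by move=> _; split=> // x /set_mem/AU/mem_set; exact: fc.
move=> [df fdf dfk]; split; first by move=> x /set_mem/AU/mem_set; exact: fc.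
exists df => [x v /AU|]; first exact: fdf.
by apply: IH dfk => -[x v] [/AU].
Qed.

Lemma cvg_line V (x v : V) : (fun t : R => x + t *: v) @ 0^' --> x.
Proof.
move=> A /(near_line v)[T [C [nT nC TC]]]; apply: nbhs_dnbhs.
by apply: filterS nT => t Tt; apply: TC => //; exact: nbhs_singleton.
Qed.

Lemma Ck_ext k V W (U : set V) (f g : V -> W) :
  open U -> (forall x, U x -> f x = g x) -> Ck k U f -> Ck k U g.
Proof.
move=> oU fg.
have gc : {in U, continuous f} -> {in U, continuous g}.
  move=> fc x Ux; have := fc x Ux; rewrite inE in Ux.
  rewrite /continuous_at fg//; apply: cvg_trans.
  by apply: near_eq_cvg; apply: filterS (open_nbhs_nbhs (conj oU Ux)) => y /fg.
case: k => [|k] [fc h]; split; [exact: gc|by []|exact: gc|].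
have [df fdf dfk] := h; exists df => // x v Ux.
apply: cvg_trans (fdf x v Ux); apply: near_eq_cvg; near=> t.
rewrite !fg//; near: t; apply: cvg_line.
exact: open_nbhs_nbhs.
Unshelve. all: by end_near. Qed.

Lemma Ck_pred k V W (U : set V) (f : V -> W) : Ck k.+1 U f -> Ck k U f.
Proof.
elim: k V U f => [|k IH] V U f [fc [df fdf dfk]]; first by split.
by split=> //; exists df => //; exact: IH.
Qed.

(** The derivatives given on the pieces agree where they overlap, since limits
    are unique; taking the limit itself as the derivative glues them. *)
Lemma Ck_local k V W (U : set V) (f : V -> W) :
  (forall x, U x -> exists A, [/\ open A, A x & Ck k A f]) -> Ck k U f.
Proof.
elim: k V U f => [|k IH] V U f loc.
  split=> // x; rewrite inE => /loc[A [oA Ax [fc _]]].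
  by apply: fc; rewrite inE.
split.
  move=> x; rewrite inE => /loc[A [oA Ax [fc _]]].
  by apply: fc; rewrite inE.
pose Q (z : V * V) (l : W) :=
  (fun t : R => t^-1 *: (f (z.1 + t *: z.2) - f z.1)) @ 0^' --> l.
pose df z : W := xget 0 (Q z).
have dfE (A : set V) (dg : V * V -> W) :
    (forall x v, A x -> Q (x, v) (dg (x, v))) ->
    forall z, (A `*` setT) z -> dg z = df z.
  move=> h [x v] [/= Ax _]; apply/esym/xget_unique; first exact: h.
  by move=> y Qy; exact: (cvg_unique (@frechet_hausdorff _ W)) Qy (h _ _ Ax).
exists df => [x v /loc[A [oA Ax [_ [dg fdg _]]]]|].
  by rewrite -(dfE A dg) //; exact: fdg.
apply: IH => -[x v] [/loc[A [oA Ax [_ [dg fdg dgk]]]] _].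
exists (A `*` setT); split=> //; first by apply: open_setX => //; exact: openT.
apply: Ck_ext (dfE A dg fdg) dgk.
by apply: open_setX => //; exact: openT.
Qed.

Lemma Ck_cst k V W (U : set V) (c : W) : Ck k U (fun=> c).
Proof.
elim: k V U c => [|k IH] V U c; first by split=> // x _; exact: cvg_cst.
split; first by move=> x _; exact: cvg_cst.
exists (fun=> 0) => // x v _; apply: cvg_near_cst; near=> t.
by rewrite subrr scaler0.
Unshelve. all: by end_near. Qed.

Lemma fst_continuous (X Y : topologicalType) : continuous (@fst X Y).
Proof. by move=> x; exact: cvg_fst. Qed.

Lemma snd_continuous (X Y : topologicalType) : continuous (@snd X Y).
Proof. by move=> x; exact: cvg_snd. Qed.

Lemma Ck_pair k V W W' (U : set V) (f : V -> W) (g : V -> W') :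
  Ck k U f -> Ck k U g -> Ck k U (fun x => (f x, g x)).
Proof.
move=> fk gk; pose d (x : V) := (x, x).
have ld : linear d by [].
pose DM := GRing.isLinear.Build R V (V * V)%type *:%R d ld.
pose D : {linear V -> (V * V)%type} := HB.pack d DM.
have := @Ck_complin R k V (V * V)%type _ _ _ D _ (Ck_prod fk gk).
rewrite (_ : D @^-1` _ = U); last by apply/seteqP; split=> [x []|x].
by apply=> x; apply: cvg_pair; exact: cvg_id.
Qed.

(** The derivative of [g \o f] at [(x, v)] is [dg (f x, df (x, v))], again a
    composite of a C^k map with a C^k pair, so that the induction on [k]
    closes. *)
Lemma Ck_comp k V V' W (U : set V) (U' : set V') (f : V -> V') (g : V' -> W) :
  open U -> open U' -> (forall x, U x -> U' (f x)) ->
  Ck k U f -> Ck k U' g -> Ck k U (g \o f).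
Proof.
elim: k V V' U U' f g => [|k IH] V V' U U' f g oU oU' fU.
  move=> [fc _] [gc _]; split=> // x Ux.
  apply: continuous_comp; first exact: fc.
  by apply: gc; rewrite inE; apply: fU; rewrite inE in Ux.
move=> fk gk; have := fk; have := gk => -[gc [dg gdg dgk]] [fc [df fdf dfk]].
split.
  move=> x Ux; apply: continuous_comp; first exact: fc.
  by apply: gc; rewrite inE; apply: fU; rewrite inE in Ux.
exists (dg \o (fun z : V * V => (f z.1, df z))).
  move=> x v Ux /=.
  have := dirderiv_cvg oU' (fU _ Ux) gdg (w := df (x, v)) _ (fdf x v Ux).
  have dgc : dg @ (f x, df (x, v)) --> dg (f x, df (x, v)).
    by apply: (Ck_continuous dgk); rewrite inE; split=> //; exact: fU.
  (* f (x + t v) is f x moved by t along the difference quotient of f *)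
  move=> /(_ dgc); apply: cvg_trans; apply: near_eq_cvg; near=> t.
  have t0 : t != 0 by near: t; exact: nbhs_dnbhs_neq.
  by rewrite /= scalerA mulfV// scale1r subrKC.
have oUT : open (U `*` (setT : set V)).
  by apply: open_setX => //; exact: openT.
have oUT' : open (U' `*` (setT : set V')).
  by apply: open_setX => //; exact: openT.
apply: (IH _ _ _ (U' `*` setT)) => //.
  by move=> z [Uz _]; split=> //; exact: fU.
apply: Ck_pair dfk.
rewrite (_ : U `*` setT = @fst V V @^-1` U); last first.
  by apply/seteqP; split=> [x []|x].
apply: (@Ck_complin R k (V * V)%type V _ U f fst); last exact: Ck_pred.
exact: fst_continuous.
Unshelve. all: by end_near. Qed.

End Calculus.

(** * Smooth maps between Frechet manifolds *)

Lemma open_preimage_in (X Y : topologicalType) (U : set X) (O : set Y)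
    (f : X -> Y) :
  open U -> {in U, continuous f} -> open O -> open (U `&` f @^-1` O).
Proof.
move=> oU fc oO; rewrite openE => x [Ux Ofx].
apply: filterI; first exact: open_nbhs_nbhs.
by apply: (fc x (mem_set Ux)); exact: open_nbhs_nbhs.
Qed.

(** A copy of a real Frechet space that is its own manifold, with one chart; it
    makes charts and their inverses smooth maps between manifolds. *)
Definition model (R : realType) (V : frechetType R) : Type := V.

Section Model.
Variables (R : realType) (V : frechetType R).

HB.instance Definition _ := Topological.copy (model V) V.

Let model_atlasP (W : frechetType R) (c : chart (model V) W) :
  @model_atlas R V W c -> is_chart c.
Proof.
case=> {W c}; rewrite /is_chart /chart_img /= image_id.
by split=> //; try exact: openT; move=> x _; exact: cvg_id.
Qed.

Let model_cover (x : model V) : exists (W : frechetType R)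
  (c : chart (model V) W), @model_atlas R V W c /\ chart_dom c x.
Proof. by exists V; eexists; split; [exact: ModelAtlas|]. Qed.

Let model_compatible (W W' : frechetType R) (c : chart (model V) W)
    (d : chart (model V) W') :
  @model_atlas R V W c -> @model_atlas R V W' d -> chart_compatible c d.
Proof.
have h : smooth_on setT (@id V).
  by move=> k; apply: (@Ck_linear _ _ _ _ idfun) => x; exact: cvg_id.
by case=> {c}; case=> {d}; rewrite /chart_compatible/= setTI image_id.
Qed.

HB.instance Definition _ := Topological_isFrechetManifold.Build R (model V)
  (@frechet_hausdorff _ V) model_atlasP model_cover model_compatible.

End Model.

Section Charts.
Variable R : realType.

Lemma chart_image_open (M : topologicalType) (V : frechetType R) (c : chart M V)
    (O : set M) :
  is_chart c -> open O -> O `<=` chart_dom c -> open (c @` O).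
Proof.
move=> [_ oi cK _ ic] oO Oc.
rewrite (_ : c @` O = chart_img c `&` chart_inv c @^-1` O).
  exact: open_preimage_in.
apply/seteqP; split=> [_ [x Ox <-]|_ [[x cx <-] /= Ox]].
  by split; [exists x => //; exact: Oc|rewrite /= cK// inE; exact: Oc].
by exists x => //; move: Ox; rewrite cK// inE.
Qed.

Lemma chartK (M : topologicalType) (V : frechetType R) (c : chart M V) x :
  is_chart c -> chart_dom c x -> chart_inv c (c x) = x.
Proof. by move=> [_ _ cK _ _] cx; rewrite cK// inE. Qed.

Lemma chart_invK (M : topologicalType) (V : frechetType R) (c : chart M V) y :
  is_chart c -> chart_img c y ->
  chart_dom c (chart_inv c y) /\ c (chart_inv c y) = y.
Proof. by move=> hc [x cx <-]; rewrite chartK. Qed.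

End Charts.

Section SmoothCategory.
Variable R : realType.
Implicit Types M N Q : frechetManifoldType R.

Lemma smooth_on_sub (V W : frechetType R) (U A : set V) (f : V -> W) :
  A `<=` U -> smooth_on U f -> smooth_on A f.
Proof. by move=> AU fs k; apply: Ck_sub (fs k). Qed.

Lemma smooth_map_on_sub M N (U A : set M) (f : M -> N) :
  A `<=` U -> smooth_map_on U f -> smooth_map_on A f.
Proof.
move=> AU [fc fs]; split; first by move=> x /set_mem/AU/mem_set; exact: fc.
move=> V W c d Ac Ad; apply: smooth_on_sub (fs _ _ _ _ Ac Ad).
by apply: image_subset => x [[/AU Ux cx] dx].
Qed.

Lemma smooth_map_on_local M N (U : set M) (f : M -> N) :
  (forall x, U x -> exists A, [/\ open A, A x & smooth_map_on A f]) ->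
  smooth_map_on U f.
Proof.
move=> loc; split.
  move=> x; rewrite inE => /loc[A [oA Ax [fc _]]].
  by apply: fc; rewrite inE.
move=> V W c d Ac Ad k.
have hc := atlas_chart _ _ Ac; have hd := atlas_chart _ _ Ad.
apply: Ck_local => _ [x [[Ux cx] dx] <-].
have [A [oA Ax [fc fs]]] := loc _ Ux.
exists (c @` (A `&` chart_dom c `&` f @^-1` chart_dom d)).
split; last exact: fs.
  apply: chart_image_open => //; last by move=> y [[]].
  have [od _ _ _ _] := hd; have [oc _ _ _ _] := hc.
  apply: open_preimage_in => //; first exact: openI.
  by move=> y /set_mem[Ay _]; apply: fc; rewrite inE.
by exists x.
Qed.

Lemma smooth_map_on_ext M N (U : set M) (f g : M -> N) : open U ->
  (forall x, U x -> f x = g x) -> smooth_map_on U f -> smooth_map_on U g.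
Proof.
move=> oU fg [fc fs].
split.
  move=> x Ux; have := fc x Ux; rewrite inE in Ux; rewrite /continuous_at fg//.
  apply: cvg_trans; apply: near_eq_cvg.
  by apply: filterS (open_nbhs_nbhs (conj oU Ux)) => y /fg.
move=> V W c d Ac Ad k.
have hc := atlas_chart _ _ Ac; have hd := atlas_chart _ _ Ad.
have E : U `&` chart_dom c `&` f @^-1` chart_dom d =
         U `&` chart_dom c `&` g @^-1` chart_dom d.
  by apply/seteqP; split=> x [[Ux cx]]; rewrite /= fg.
rewrite -E; apply: Ck_ext (fs _ _ _ _ Ac Ad k).
  apply: chart_image_open => //; last by move=> y [[]].
  have [od _ _ _ _] := hd; have [oc _ _ _ _] := hc.
  apply: open_preimage_in => //; first exact: openI.
  by move=> y /set_mem[Uy _]; apply: fc; rewrite inE.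
by move=> _ [x [[Ux cx] _] <-] /=; rewrite chartK// fg.
Qed.

(** Near [x] the local representative factors through a chart at [f x], chosen
    point by point; locality of C^k then suffices. *)
Lemma smooth_map_on_comp M N Q (U : set M) (U' : set N) (f : M -> N)
    (g : N -> Q) :
  open U -> open U' -> (forall x, U x -> U' (f x)) ->
  smooth_map_on U f -> smooth_map_on U' g -> smooth_map_on U (g \o f).
Proof.
move=> oU oU' fU [fc fs] [gc gs].
have gfc : {in U, continuous (g \o f)}.
  move=> x Ux; apply: continuous_comp; first exact: fc.
  by apply: gc; rewrite inE; apply: fU; rewrite inE in Ux.
split=> // V W c e Ac Ae k; apply: Ck_local => _ [x [[Ux cx] ex] <-].
have [V' [d [Ad dx]]] := atlas_cover (f x).
have hc := atlas_chart _ _ Ac; have hd := atlas_chart _ _ Ad.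
have he := atlas_chart _ _ Ae.
have [oc _ _ _ _] := hc; have [od _ _ _ _] := hd; have [oe _ _ _ _] := he.
pose O := (U `&` chart_dom c `&` f @^-1` chart_dom d)
  `&` (g \o f) @^-1` chart_dom e.
have oO : open O.
  apply: open_preimage_in => //.
    apply: open_preimage_in => //; first exact: openI.
    by move=> y /set_mem[Uy _]; apply: fc; rewrite inE.
  by move=> y /set_mem[[Uy _] _]; apply: gfc; rewrite inE.
have oO' : open (U' `&` chart_dom d `&` g @^-1` chart_dom e).
  apply: open_preimage_in => //; first exact: openI.
  by move=> y /set_mem[Uy _]; apply: gc; rewrite inE.
have Oc : O `<=` chart_dom c by move=> y [[[]]].
have oA := chart_image_open hc oO Oc.
have oA' : open (d @` (U' `&` chart_dom d `&` g @^-1` chart_dom e)).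
  by apply: chart_image_open => // y [[]].
exists (c @` O); split=> //; first by exists x => //; split.
apply: (@Ck_ext R k _ _ _
  ((e \o g \o chart_inv d) \o (d \o f \o chart_inv c))) => //.
  by move=> _ [y [[[Uy cy] dy] ey] <-] /=; rewrite chartK// chartK.
apply: Ck_comp oA oA' _ _ (gs _ _ _ _ Ad Ae k).
  move=> _ [y [[[Uy cy] dy] ey] <-] /=; rewrite chartK//.
  by exists (f y) => //; split=> //; split=> //; exact: fU.
apply: Ck_sub (fs _ _ _ _ Ac Ad k).
by apply: image_subset => y [].
Qed.

Lemma smooth_map_on_cst M N (U : set M) (y : N) : smooth_map_on U (fun=> y).
Proof.
split; first by move=> x _; exact: cvg_cst.
by move=> V W c d Ac Ad k; exact: Ck_cst.
Qed.

Lemma smooth_map_on_pair M N N' (U : set M) (f : M -> N) (g : M -> N') :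
  smooth_map_on U f -> smooth_map_on U g ->
  smooth_map_on U (fun x => (f x, g x) : (N * N')%type).
Proof.
move=> [fc fs] [gc gs]; split.
  by move=> x Ux; apply: cvg_pair; [exact: fc|exact: gc].
move=> V W c e Ac Ae; case: W e / Ae => W W' d d' Ad Ad' k.
apply: Ck_pair.
  apply: Ck_sub (fs _ _ _ _ Ac Ad k).
  by apply: image_subset => y [[? ?] []].
apply: Ck_sub (gs _ _ _ _ Ac Ad' k).
by apply: image_subset => y [[? ?] []].
Qed.

Lemma smooth_map_fst M N : smooth_map (@fst M N).
Proof.
split; first by move=> x _; exact: cvg_fst.
move=> V W e c' Ae Ac'; case: V e / Ae => V V' c d Ac Ad k.
have [h _] := atlas_compatible _ _ _ _ Ac Ac'.
apply: Ck_sub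
  (@Ck_complin R k (V * V')%type V _ _ _ fst (@fst_continuous _ _) (h k)).
by move=> _ [[x y] [[_ [/= cx dy]] c'x] <-] /=; exists x.
Qed.

Lemma smooth_map_snd M N : smooth_map (@snd M N).
Proof.
split; first by move=> x _; exact: cvg_snd.
move=> V W e c' Ae Ac'; case: V e / Ae => V V' c d Ac Ad k.
have [h _] := atlas_compatible _ _ _ _ Ad Ac'.
apply: Ck_sub
  (@Ck_complin R k (V * V')%type V' _ _ _ snd (@snd_continuous _ _) (h k)).
by move=> _ [[x y] [[_ [/= cx dy]] c'x] <-] /=; exists y.
Qed.

Lemma smooth_on_model (V W : frechetType R) (U : set V) (f : V -> W) :
  smooth_on U f <-> @smooth_map_on R (model V) (model W) U f.
Proof.
split=> [fs|[fc fs]].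
  split; first exact: (Ck_continuous (fs 0%N)).
  move=> V' W' c d Ac Ad; case: V' c / Ac; case: W' d / Ad.
  by apply: smooth_on_sub fs => /= _ [x [[Ux _] _] <-].
have := fs _ _ _ _ (ModelAtlas V) (ModelAtlas W).
by rewrite /= preimage_setT !setIT image_id.
Qed.

Lemma smooth_chart M (V : frechetType R) (c : chart M V) : in_maximal_atlas c ->
  @smooth_map_on R M (model V) (chart_dom c) c /\
  @smooth_map_on R (model V) M (chart_img c) (chart_inv c).
Proof.
move=> [[_ _ cK cc ic] comp]; split; split=> //.
  move=> V' W' d e Ad Ae; case: W' e / Ae.
  have [_ h] := comp _ _ Ad.
  by rewrite /= preimage_setT setIT.
move=> V' W' d e Ad Ae; case: V' d / Ad.
have [h _] := comp _ _ Ae.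
apply: smooth_on_sub h => /= _ [y [[[x cx <-] _] ex] <-].
by exists x => //; split=> //; move: ex; rewrite /= cK// inE.
Qed.

Lemma in_maximal_atlas_smooth M (V : frechetType R) (c : chart M V) :
  open (chart_dom c) -> open (chart_img c) ->
  (forall x, chart_dom c x -> chart_inv c (c x) = x) ->
  @smooth_map_on R M (model V) (chart_dom c) c ->
  @smooth_map_on R (model V) M (chart_img c) (chart_inv c) ->
  in_maximal_atlas c.
Proof.
move=> oc oi cK [cc cs] [ic si]; split.
  by split=> // x /set_mem; exact: cK.
move=> W d Ad; split.
  have := si _ _ _ _ (ModelAtlas V) Ad.
  apply: smooth_on_sub => _ [x [cx dx] <-].
  by exists (c x) => //; split; [split=> //; exists x|rewrite /= cK].
have := cs _ _ _ _ Ad (ModelAtlas V); apply: smooth_on_sub => _ [x [cx dx] <-].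
by exists x.
Qed.

Lemma atlas_in_maximal M (V : frechetType R) (c : chart M V) :
  atlas V c -> in_maximal_atlas c.
Proof.
by move=> Ac; split; [exact: atlas_chart|move=> W d; exact: atlas_compatible].
Qed.
Lemma smooth_map_on_compT M N Q (U : set M) (f : M -> N) (g : N -> Q) :
  open U -> smooth_map_on U f -> smooth_map g -> smooth_map_on U (g \o f).
Proof. by move=> oU; apply: smooth_map_on_comp oU openT _. Qed.

(** [model (V * W)] and [model V * model W] have different atlases, so pairing
    into the former is a separate statement. *)
Lemma smooth_map_on_pair_model M (V W : frechetType R) (U : set M)
    (f : M -> model V) (g : M -> model W) :
  smooth_map_on U f -> smooth_map_on U g ->
  @smooth_map_on R M (model (V * W)%type) U (fun x => (f x, g x)).
Proof.
move=> [fc fs] [gc gs]; split.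
  by move=> x Ux; apply: cvg_pair; [exact: fc|exact: gc].
move=> V' W' c e Ac Ae; case: W' e / Ae => k.
by apply: Ck_pair; [exact: (fs _ _ _ _ Ac (ModelAtlas V))|
  exact: (gs _ _ _ _ Ac (ModelAtlas W))].
Qed.

Lemma smooth_map_linear_model (V W : frechetType R) (l : {linear V -> W}) :
  continuous l -> @smooth_map R (model V) (model W) l.
Proof. by move=> lc; apply/smooth_on_model => k; exact: Ck_linear. Qed.

Lemma smooth_map_open_preimage M N (f : M -> N) (O : set N) :
  smooth_map f -> open O -> open (f @^-1` O).
Proof.
move=> [fc _] oO; rewrite -[X in open X]setTI; apply: open_preimage_in => //.
exact: openT.
Qed.

(** In the charts where [f] is a projection, freezing the second coordinate at
    its value at one point of the fibre yields a smooth local section of [f];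
    and [h] is [h \o f] composed with it. *)
Lemma smooth_map_on_descend M N Q (f : M -> N) (O : set N) (h : N -> Q) :
  submersion f -> open O -> (forall y, O y -> exists x, f x = y) ->
  smooth_map_on (f @^-1` O) (h \o f) -> smooth_map_on O h.
Proof.
move=> [fs fsub] oO fO hf; apply: smooth_map_on_local => b Ob.
have [a fab] := fO b Ob.
have [V [W [c [d [mc md ca fcd dfc]]]]] := fsub a.
have [cs cis] := smooth_chart mc; have [ds dis] := smooth_chart md.
have [[oc oi cK cc ic] _] := mc; have [[od odi dK dc dic] _] := md.
pose w := (c a).2.
(* the local section is chart_inv c \o l *)
pose l (z : N) : model (V * W)%type := (d z, w).
have ls : smooth_map_on (chart_dom d) l.
  by apply: (@smooth_map_on_pair_model N V W) => //; exact: smooth_map_on_cst.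
have oA : open (chart_dom d `&` l @^-1` chart_img c).
  by apply: open_preimage_in => //; case: ls.
pose A := O `&` (chart_dom d `&` l @^-1` chart_img c).
have oA' : open A by exact: openI.
have fsig z : A z -> f (chart_inv c (l z)) = z.
  move=> [_ [dz lz]]; have [h1 h2] := chart_invK mc.1 lz.
  have dfz : chart_dom d (f (chart_inv c (l z))).
    by apply: fcd; exists (chart_inv c (l z)).
  have := dfc _ h1; rewrite h2 /= => /(congr1 (chart_inv d)).
  by rewrite !dK ?inE.
exists A; split=> //.
  have db : chart_dom d b by rewrite -fab; apply: fcd; exists a.
  split=> //; split=> //; exists a => //.
  by rewrite /l -fab dfc// /w -surjective_pairing.
apply: (@smooth_map_on_ext _ _ _ ((h \o f) \o (chart_inv c \o l))) => //.
  by move=> z Az; rewrite /= fsig.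
apply: (smooth_map_on_comp (U' := f @^-1` O)) hf => //.
- exact: smooth_map_open_preimage.
- by move=> z Az; rewrite /= fsig//; case: Az.
apply: (@smooth_map_on_comp N (model (V * W)%type) M _ (chart_img c) l) cis
  => //.
- by move=> z [_ []].
- by apply: smooth_map_on_sub ls => z [_ []].
Qed.

Lemma submersion_same_structure M (T : Type) (q : M -> T)
    (X Y : frechet_structure R T) :
  (forall y, exists x, q x = y) ->
  @submersion R M (with_structure X) q ->
  @submersion R M (with_structure Y) q ->
  same_structure X Y.
Proof.
move=> qs qX qY; split.
  apply: (@smooth_map_on_descend M (with_structure X) (with_structure Y)
    q setT id) => //.
    exact: openT.
  by rewrite preimage_setT; case: qY.
apply: (@smooth_map_on_descend M (with_structure Y) (with_structure X)
  q setT id) => //.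
  exact: openT.
by rewrite preimage_setT; case: qX.
Qed.
End SmoothCategory.

(** * Principal bundles *)

Section PrincipalBundle.
Variables (R : realType) (G : frechetLieGroupType R).
Variables (M P : frechetManifoldType R) (B : principalBundle G M P).

Definition pb_trivialization (U : set M) (Phi : P -> M * G)
    (Psi : M * G -> P) :=
  [/\ open U, diffeo_on (pb_proj B @^-1` U) (U `*` setT) Phi Psi,
      forall p, U (pb_proj B p) -> (Phi p).1 = pb_proj B p &
      forall p g, U (pb_proj B p) ->
        Phi (pb_act B p g) = ((Phi p).1, ((Phi p).2 * g)%g)].

Section Trivialization.
Variables (U : set M) (Phi : P -> M * G) (Psi : M * G -> P).
Hypothesis hT : pb_trivialization U Phi Psi.

Lemma triv_open : open U. Proof. by case: hT. Qed.

Lemma triv_fst p : U (pb_proj B p) -> (Phi p).1 = pb_proj B p.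
Proof. by case: hT => _ _ h _; exact: h. Qed.

Lemma triv_snd p g : U (pb_proj B p) ->
  (Phi (pb_act B p g)).2 = ((Phi p).2 * g)%g.
Proof. by case: hT => _ _ _ h Up; rewrite h. Qed.

Lemma trivK p : U (pb_proj B p) -> Psi (Phi p) = p.
Proof. by case: hT => _ [_ _ _ _ [h _ _ _]] _ _ Up; rewrite h// inE. Qed.

Lemma triv_projV x g : U x -> pb_proj B (Psi (x, g)) = x.
Proof.
move=> Ux; have [_ [_ _ _ sub [_ h _ _]] hf _] := hT.
have UP : U (pb_proj B (Psi (x, g))).
  by apply: (sub (Psi (x, g))); exists (x, g).
by rewrite -hf// h// inE.
Qed.

Lemma trivVK x g : U x -> Phi (Psi (x, g)) = (x, g).
Proof. by case: hT => _ [_ _ _ _ [_ h _ _]] _ _ Ux; rewrite h// inE. Qed.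

Lemma triv_act x g h : U x -> pb_act B (Psi (x, g)) h = Psi (x, (g * h)%g).
Proof.
move=> Ux; have UP : U (pb_proj B (Psi (x, g))) by rewrite triv_projV.
have [_ _ _ hact] := hT.
rewrite -[LHS]trivK ?pb_proj_act//; congr Psi.
by rewrite hact// trivVK.
Qed.

Lemma triv_decomp p : U (pb_proj B p) ->
  pb_act B (Psi (pb_proj B p, 1%g)) (Phi p).2 = p.
Proof.
move=> Up; rewrite triv_act// mul1g -(triv_fst Up) -surjective_pairing.
exact: trivK.
Qed.

End Trivialization.

Lemma pb_trivializationP x :
  exists U Phi Psi, U x /\ pb_trivialization U Phi Psi.
Proof.
have [U [Phi [Psi [oU Ux d h h']]]] := pb_trivial B x.
by exists U, Phi, Psi; split.
Qed.

Lemma pb_act_transitive p p' : pb_proj B p = pb_proj B p' ->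
  exists g, p' = pb_act B p g.
Proof.
move=> pp'; have [U [Phi [Psi [Up hT]]]] := pb_trivializationP (pb_proj B p).
exists ((Phi p).2^-1 * (Phi p').2)%g.
rewrite -{1}(triv_decomp hT Up) -pb_actM mulgA mulgV mul1g pp'.
by rewrite (triv_decomp hT)// -pp'.
Qed.

Lemma pb_act_free p g h : pb_act B p g = pb_act B p h -> g = h.
Proof.
have [U [Phi [Psi [Up hT]]]] := pb_trivializationP (pb_proj B p).
move=> /(congr1 (fun p => (Phi p).2)); rewrite !(triv_snd hT)//.
exact: mulgI.
Qed.

End PrincipalBundle.

(** * The quotient topology and fibre coordinates *)

Section AssocBundle.
Variables (R : realType) (G : frechetLieGroupType R).
Variables (M P : frechetManifoldType R) (B : principalBundle G M P).
Variables (E : riggedHilbertType R) (rho : smoothRepresentation G E).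

Local Notation cls := (assoc_class B rho).
Local Notation base := (fun x : P * realify E => pb_proj B x.1).

Lemma repK g v : rho g (rho g^-1%g v) = v.
Proof. by rewrite -repM mulgV rep1. Qed.

Lemma repVK g v : rho g^-1%g (rho g v) = v.
Proof. by rewrite -repM mulVg rep1. Qed.

Lemma assoc_class_eq p p' v v' : cls p v = cls p' v' ->
  exists g, p' = pb_act B p g /\ v' = rho g^-1%g v.
Proof.
by move=> /eqmodP/asboolP[g [-> ->]]; exists g.
Qed.

Lemma assoc_class_act p g v :
  cls (pb_act B p g) v = cls p (rho g v).
Proof.
apply/eqmodP/asboolP; exists g^-1%g.
by rewrite /= invgK -pb_actM mulgV pb_act1.
Qed.

(** The quotient set under a name of its own, to carry the quotient topology and
    then the manifold structure. *)
Definition assoc_total : Type :=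
  quotient_topology {eq_quot (assoc_equiv B rho)}%qT.

HB.instance Definition _ := Topological.on assoc_total.

Definition assoc_pi (x : P * realify E) : assoc_total := cls x.1 x.2.

Definition assoc_repr (e : assoc_total) : P * realify E :=
  repr (e : {eq_quot (assoc_equiv B rho)}%qT).

Lemma assoc_reprK e : assoc_pi (assoc_repr e) = e.
Proof. by rewrite /assoc_pi /assoc_class -surjective_pairing reprK. Qed.

Lemma assoc_repr_class p v : exists g,
  assoc_repr (cls p v) = (pb_act B p g, rho g^-1%g v : realify E).
Proof.
have /esym/assoc_class_eq[g [h1 h2]] := assoc_reprK (cls p v).
by exists g; rewrite [LHS]surjective_pairing; congr pair.
Qed.

Lemma open_assocE (O : set assoc_total) : open O = open (assoc_pi @^-1` O).
Proof.
rewrite /open/= /quotient_open; congr open; apply/seteqP.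
by split=> -[].
Qed.

Lemma assoc_pi_continuous : continuous assoc_pi.
Proof. by apply/continuousP => O; rewrite open_assocE. Qed.

(** Universal property of the quotient topology over an open set, in the sense
    of continuity at each point of it. *)
Lemma assoc_continuous_in (Z : topologicalType) (O : set assoc_total)
    (f : assoc_total -> Z) :
  open O -> {in assoc_pi @^-1` O, continuous (f \o assoc_pi)} ->
  {in O, continuous f}.
Proof.
move=> oO fc e; rewrite inE => Oe N; rewrite nbhsE => -[N' [oN' N'e] N'N].
have : open (O `&` f @^-1` N').
  rewrite open_assocE; apply: (open_preimage_in (f := f \o assoc_pi)) => //.
  by rewrite -open_assocE.
move=> o; have : nbhs e (O `&` f @^-1` N') by apply: open_nbhs_nbhs.
by apply: filterS => e' [_ /N'N].
Qed.

Definition assoc_proj (e : assoc_total) : M := pb_proj B (assoc_repr e).1.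

Lemma assoc_projE p v : assoc_proj (cls p v) = pb_proj B p.
Proof.
rewrite /assoc_proj.
by have [g ->] := assoc_repr_class p v; exact: pb_proj_act.
Qed.

(** Value in [E] of a class read in the gauge [gam]; for an equivariant [gam]
    the representative does not matter. Local trivialisations and the pointwise
    choice of base points both give such gauges. *)
Definition fibre_coord (gam : P -> G) (e : assoc_total) : realify E :=
  rho (gam (assoc_repr e).1) (assoc_repr e).2.

Lemma fibre_coordE gam p v : (forall g, gam (pb_act B p g) = (gam p * g)%g) ->
  fibre_coord gam (cls p v) = rho (gam p) v.
Proof.
move=> gamE; rewrite /fibre_coord; have [g ->] := assoc_repr_class p v.
by rewrite /= gamE -repM -mulgA mulgV mulg1.
Qed.

Lemma pb_proj_fst_smooth : smooth_map base.
Proof.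
apply: (smooth_map_on_compT openT (smooth_map_fst _ _)).
exact: pb_proj_smooth.
Qed.

Section Trivialization.
Variables (U : set M) (Phi : P -> M * G) (Psi : M * G -> P).
Hypothesis hT : pb_trivialization B U Phi Psi.
Let gam p := (Phi p).2.

Let oU : open U. Proof. exact: triv_open hT. Qed.

Let oPU : open (base @^-1` U).
Proof. by apply: smooth_map_open_preimage => //; exact: pb_proj_fst_smooth. Qed.

Lemma triv_fst_smooth :
  smooth_map_on (base @^-1` U)
                (fun x => Phi x.1).
Proof.
have [_ [oW _ _ _ [_ _ Phis _]] _ _] := hT.
apply: (smooth_map_on_comp (U' := pb_proj B @^-1` U) (f := fst)) Phis => //.
by apply: smooth_map_on_sub (smooth_map_fst _ _).
Qed.

Lemma gauge_smooth :
  smooth_map_on (base @^-1` U)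
    (fun x => rho (gam x.1) x.2 : realify E).
Proof.
apply: (smooth_map_on_compT (f := fun x : P * realify E => (gam x.1, x.2)))
  (rep_smooth rho) => //.
apply: smooth_map_on_pair; last first.
  by apply: smooth_map_on_sub (smooth_map_snd _ _).
by apply: smooth_map_on_compT triv_fst_smooth (smooth_map_snd _ _).
Qed.

Lemma fibre_coord_pi p v : U (pb_proj B p) ->
  fibre_coord gam (cls p v) = rho (gam p) v.
Proof. by move=> Up; apply: fibre_coordE => g; rewrite /gam (triv_snd hT). Qed.

Lemma fibre_coordK e : U (assoc_proj e) ->
  cls (Psi (assoc_proj e, 1%g)) (fibre_coord gam e) = e.
Proof.
rewrite -[e]assoc_reprK /assoc_pi; move: (assoc_repr e) => [p v] /=.
rewrite assoc_projE => Up; rewrite fibre_coord_pi//.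
by rewrite -assoc_class_act (triv_decomp hT).
Qed.

Lemma assoc_proj_triv x g v : U x ->
  assoc_proj (cls (Psi (x, g)) v) = x.
Proof. by move=> Ux; rewrite assoc_projE (triv_projV hT). Qed.

Lemma fibre_coord_triv x g v : U x ->
  fibre_coord gam (cls (Psi (x, g)) v) = rho g v.
Proof.
by move=> Ux; rewrite fibre_coord_pi ?(triv_projV hT)// /gam (trivVK hT).
Qed.

Lemma triv_section_smooth : smooth_map_on (U `*` setT)
  (fun z : M * realify E => (Psi (z.1, 1%g), z.2)).
Proof.
have [_ [_ oW _ _ [_ _ _ Psis]] _ _] := hT.
have oUE : open (U `*` (setT : set (realify E))).
  by apply: open_setX => //; exact: openT.
apply: smooth_map_on_pair; last first.
  by apply: smooth_map_on_sub (smooth_map_snd _ _).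
apply: (smooth_map_on_comp (f := fun z : M * realify E => (z.1, 1%g : G))) Psis
  => //.
apply: smooth_map_on_pair; last exact: smooth_map_on_cst.
by apply: smooth_map_on_sub (smooth_map_fst _ _).
Qed.

Lemma triv_coord_smooth :
  smooth_map_on (base @^-1` U)
    (fun x => (pb_proj B x.1, rho (gam x.1) x.2 : realify E)).
Proof.
apply: smooth_map_on_pair gauge_smooth.
by apply: smooth_map_on_sub pb_proj_fst_smooth.
Qed.

End Trivialization.

(** * The manifold structure of the associated bundle *)

Definition assoc_chart (V : frechetType R) (c : chart M V) (U : set M)
    (Phi : P -> M * G) (Psi : M * G -> P) :
    chart assoc_total (V * realify E)%type :=
  Chart (assoc_proj @^-1` (U `&` chart_dom c))
    (fun e => (c (assoc_proj e), fibre_coord (fun p => (Phi p).2) e)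
              : V * realify E)
    (fun z => cls (Psi (chart_inv c z.1, 1%g)) z.2).

Inductive assoc_atlas : forall V : frechetType R, chart assoc_total V -> Prop :=
  AssocAtlas (V : frechetType R) (c : chart M V) U Phi Psi of
    atlas V c & pb_trivialization B U Phi Psi :
    @assoc_atlas (V * realify E)%type (assoc_chart c U Phi Psi).

Lemma assoc_proj_continuous : continuous assoc_proj.
Proof.
suff h : {in setT, continuous assoc_proj}.
  by move=> e; apply: h; rewrite inE.
apply: assoc_continuous_in; first exact: openT.
move=> x _; rewrite (_ : _ \o _ = fun x : P * realify E => pb_proj B x.1).
  by have [h _] := pb_proj_fst_smooth; apply: h; rewrite inE.
by apply/funext => y; exact: assoc_projE.
Qed.

Lemma assoc_proj_open (O : set M) : open O ->
  open (assoc_proj @^-1` O).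
Proof. by move/continuousP: assoc_proj_continuous; apply. Qed.

Lemma assoc_pi_projE (O : set M) : assoc_pi @^-1` (assoc_proj @^-1` O) =
  base @^-1` O.
Proof. by apply/seteqP; split=> x /=; rewrite assoc_projE. Qed.

Lemma open_pb_fst (O : set M) : open O -> open (base @^-1` O).
Proof. by apply: smooth_map_open_preimage; exact: pb_proj_fst_smooth. Qed.

Section Chart.
Variables (V : frechetType R) (c : chart M V) (U : set M).
Variables (Phi : P -> M * G) (Psi : M * G -> P).
Hypotheses (Ac : atlas V c) (hT : pb_trivialization B U Phi Psi).
Let e := assoc_chart c U Phi Psi.
Let hc := atlas_chart _ _ Ac.
Let oUc : open (U `&` chart_dom c).
Proof. by apply: openI; [exact: triv_open hT|case: hc]. Qed.

Lemma assoc_chart_image (O : set M) : O `<=` U `&` chart_dom c ->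
  e @` (assoc_proj @^-1` O) = (c @` O) `*` setT.
Proof.
move=> OU; apply/seteqP; split=> [_ [x Ox <-]|[_ v] [/= [x Ox <-] _]].
  by split=> //=; exists (assoc_proj x).
have Ux := (OU _ Ox).1.
exists (cls (Psi (x, 1%g)) v).
  by rewrite /= (assoc_proj_triv hT).
by rewrite /= (assoc_proj_triv hT)// (fibre_coord_triv hT)// rep1.
Qed.

Lemma assoc_chartK x : chart_dom e x -> chart_inv e (e x) = x.
Proof. by move=> [Ux cx] /=; rewrite chartK// (fibre_coordK hT). Qed.

Lemma assoc_chart_pi_smooth :
  @smooth_map_on R (P * realify E)%type (model (V * realify E)%type)
    (assoc_pi @^-1` chart_dom e) (e \o assoc_pi).
Proof.
rewrite assoc_pi_projE; have oO := open_pb_fst oUc.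
apply: (@smooth_map_on_ext R (P * realify E)%type (model (V * realify E)%type)
  _ (fun x => (c (pb_proj B x.1), rho (Phi x.1).2 x.2))) => //.
  by move=> x [Ux cx] /=; rewrite assoc_projE (fibre_coord_pi hT).
apply: (@smooth_map_on_pair_model R (P * realify E)%type V (realify E)).
  apply: (@smooth_map_on_comp R (P * realify E)%type M (model V) _ (chart_dom c)
    (fun x => pb_proj B x.1) c) => //.
  - by case: hc.
  - by move=> x [].
  - by apply: smooth_map_on_sub pb_proj_fst_smooth.
  - by have [] := smooth_chart (atlas_in_maximal Ac).
by apply: smooth_map_on_sub (gauge_smooth hT) => x [].
Qed.

Lemma chart_cylinder_open :
  open ((c @` (U `&` chart_dom c)) `*` (setT : set (realify E))).
Proof.
apply: open_setX; last exact: openT.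
by apply: chart_image_open => //; move=> x [].
Qed.

Lemma assoc_chart_lift_smooth :
  @smooth_map_on R (model (V * realify E)%type) (P * realify E)%type
    ((c @` (U `&` chart_dom c)) `*` setT)
    (fun z => (Psi (chart_inv c z.1, 1%g), z.2)).
Proof.
have oI := chart_cylinder_open.
pose VE := (V * realify E)%type : frechetType R.
apply: (@smooth_map_on_comp R (model VE) (M * realify E)%type
  (P * realify E)%type _ (U `*` setT) (fun z => (chart_inv c z.1, z.2))
  (fun z => (Psi (z.1, 1%g), z.2))) => //.
- by apply: open_setX; [exact: triv_open hT|exact: openT].
- by move=> [_ v] [/= [x [Ux cx] <-] _]; rewrite chartK.
- apply: smooth_map_on_pair; last first.
    by apply: smooth_map_on_sub
      (@smooth_map_linear_model R VE (realify E) snd (@snd_continuous _ _)).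
  apply: (@smooth_map_on_comp R (model VE) (model V) M _ (chart_img c) fst)
    => //.
  + by case: hc.
  + by move=> [_ v] [/= [x [Ux cx] <-] _]; exists x.
  + by apply: smooth_map_on_sub
      (@smooth_map_linear_model R VE V fst (@fst_continuous _ _)).
  + by have [] := smooth_chart (atlas_in_maximal Ac).
- exact: (triv_section_smooth hT).
Qed.

Lemma assoc_chart_is_chart : is_chart e.
Proof.
have oe : open (chart_dom e) by exact: assoc_proj_open.
have imgE : chart_img e = (c @` (U `&` chart_dom c)) `*` setT.
  exact: assoc_chart_image.
split=> //.
- by rewrite imgE; exact: chart_cylinder_open.
- by move=> x; rewrite inE; exact: assoc_chartK.
- by apply: assoc_continuous_in => //; have [] := assoc_chart_pi_smooth.
- rewrite imgE => z hz.
  apply: (@continuous_comp _ _ _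
    (fun z : V * realify E => (Psi (chart_inv c z.1, 1%g), z.2)) assoc_pi);
    last exact: assoc_pi_continuous.
  by have [h _] := assoc_chart_lift_smooth; exact: h.
Qed.

End Chart.

(** The transition map lifts to [P * E] by the section [Psi (_, 1)] of the first
    trivialisation, and the second chart is smooth on [P * E]. *)
Lemma assoc_chart_transition_smooth (V V' : frechetType R) (c : chart M V)
    (c' : chart M V') U Phi Psi U' Phi' Psi' : atlas V c -> atlas V' c' ->
  pb_trivialization B U Phi Psi -> pb_trivialization B U' Phi' Psi' ->
  let e := assoc_chart c U Phi Psi in let e' := assoc_chart c' U' Phi' Psi' in
  smooth_on (e @` (chart_dom e `&` chart_dom e')) (e' \o chart_inv e).
Proof.
move=> Ac Ac' hT hT' e e'.
have hc := atlas_chart _ _ Ac; have hc' := atlas_chart _ _ Ac'.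
have oO : open ((U `&` chart_dom c) `&` (U' `&` chart_dom c')).
  by apply: openI; apply: openI;
    first [exact: triv_open hT|exact: triv_open hT'|by case: hc|by case: hc'].
rewrite (assoc_chart_image hT
  (O := (U `&` chart_dom c) `&` (U' `&` chart_dom c'))); last by move=> x [].
apply/smooth_on_model.
apply: (@smooth_map_on_comp R (model (V * realify E)%type) (P * realify E)%type
  (model (V' * realify E)%type) _ (assoc_pi @^-1` chart_dom e')
  (fun z => (Psi (chart_inv c z.1, 1%g), z.2)) (e' \o assoc_pi)).
- apply: open_setX; last exact: openT.
  by apply: chart_image_open => //; move=> x [[]].
- rewrite assoc_pi_projE; apply: open_pb_fst.
  by apply: openI; [exact: triv_open hT'|case: hc'].
- move=> [_ v] [/= [x [[Ux cx] [Ux' cx']] <-] _].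
  by rewrite chartK// assoc_projE (triv_projV hT).
- apply: smooth_map_on_sub (assoc_chart_lift_smooth Ac hT).
  by move=> [y v] [/= [x [? ?] ?] _]; split=> //; exists x.
- exact: assoc_chart_pi_smooth.
Qed.

Let assoc_atlas_chart (V : frechetType R) (e : chart assoc_total V) :
  assoc_atlas e -> is_chart e.
Proof. by case=> {V e} V c U Phi Psi Ac hT; exact: assoc_chart_is_chart. Qed.

Let assoc_cover (x : assoc_total) :
  exists (V : frechetType R) (e : chart assoc_total V),
  assoc_atlas e /\ chart_dom e x.
Proof.
have [V [c [Ac cx]]] := atlas_cover (assoc_proj x).
have [U [Phi [Psi [Ux hT]]]] := pb_trivializationP B (assoc_proj x).
by exists (V * realify E)%type; eexists; split; [exact: (AssocAtlas Ac hT)|].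
Qed.

Let assoc_compatible (V W : frechetType R) (e : chart assoc_total V)
    (e' : chart assoc_total W) :
  assoc_atlas e -> assoc_atlas e' -> chart_compatible e e'.
Proof.
case=> {V e} V c U Phi Psi Ac hT; case=> {W e'} V' c' U' Phi' Psi' Ac' hT'.
split; first exact: assoc_chart_transition_smooth.
by rewrite setIC; exact: assoc_chart_transition_smooth.
Qed.

Let cluster_image (X Y : topologicalType) (f : X -> Y) (a b : X) :
  hausdorff_space Y -> {for a, continuous f} -> {for b, continuous f} ->
  cluster (nbhs a) b -> f a = f b.
Proof.
move=> hY fa fb cl; apply: hY => S T nS nT.
by have [x [Sx Tx]] := cl _ _ (fa _ nS) (fb _ nT); exists (f x).
Qed.

(** Two points that cannot be separated have the same projection, as [M] is
    separated, so a single chart contains both, and its target is separated. *)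
Let assoc_hausdorff : hausdorff_space assoc_total.
Proof.
move=> a b cl.
have ab : assoc_proj a = assoc_proj b.
  apply: cluster_image cl; first exact: manifold_hausdorff.
    exact: assoc_proj_continuous.
  exact: assoc_proj_continuous.
have [V [c [Ac ca]]] := atlas_cover (assoc_proj a).
have [U [Phi [Psi [Ua hT]]]] := pb_trivializationP B (assoc_proj a).
have [_ _ _ ec _] := assoc_chart_is_chart Ac hT.
rewrite -(assoc_chartK Ac hT (x := a)) // -(assoc_chartK Ac hT (x := b));
  last by rewrite /= -ab.
congr chart_inv; apply: cluster_image cl.
- exact: frechet_hausdorff.
- by apply: ec; rewrite inE.
- by apply: ec; rewrite inE /= -ab.
Qed.

HB.instance Definition _ := Topological_isFrechetManifold.Build R assoc_total
  assoc_hausdorff assoc_atlas_chart assoc_cover assoc_compatible.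

(** * The quotient map is a submersion *)

Lemma assoc_pi_smooth : smooth_map (assoc_pi : P * realify E -> assoc_total).
Proof.
split; first by move=> x _; exact: assoc_pi_continuous.
move=> V W c e Ac Ae; case: W e / Ae => W d U Phi Psi Ad hT.
have [_ h] := assoc_chart_pi_smooth Ad hT.
apply: smooth_on_sub (h _ _ _ _ Ac (ModelAtlas _)) => _ [x [[_ cx] dx] <-].
by exists x => //; split.
Qed.

Section SubmersionChart.
Variables (V W : frechetType R) (c : chart M V) (d : chart G W) (U : set M).
Variables (Phi : P -> M * G) (Psi : M * G -> P).
Hypotheses (Ac : atlas V c) (Ad : atlas W d).
Hypothesis hT : pb_trivialization B U Phi Psi.

(** The coordinates [((x, g v), g)] instead of the product coordinates
    [(x, g, v)]: the first component is then the chart of the class. *)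
Definition submersion_chart :
    chart (P * realify E)%type (V * realify E * W)%type :=
  Chart [set x | (U `&` chart_dom c) (pb_proj B x.1) /\ chart_dom d (Phi x.1).2]
    (fun x => ((c (pb_proj B x.1), rho (Phi x.1).2 x.2), d (Phi x.1).2)
              : V * realify E * W)
    (fun z => (Psi (chart_inv c z.1.1, chart_inv d z.2),
               rho (chart_inv d z.2)^-1%g z.1.2)).
Local Notation C := submersion_chart.

Let hc := atlas_chart _ _ Ac.
Let hd := atlas_chart _ _ Ad.

Let gauge : P * realify E -> G := fun x => (Phi x.1).2.

Let gauge_sm :
  smooth_map_on (base @^-1` U) gauge.
Proof.
apply: smooth_map_on_compT (triv_fst_smooth hT) (smooth_map_snd _ _).
by apply: open_pb_fst; exact: triv_open hT.
Qed.

Lemma submersion_chart_dom : open (chart_dom C).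
Proof.
rewrite (_ : chart_dom C = (base @^-1` U `&`
  gauge @^-1` chart_dom d) `&` base @^-1` chart_dom c).
  apply: openI; last by apply: open_pb_fst; case: hc.
  apply: open_preimage_in; last by case: hd.
    by apply: open_pb_fst; exact: triv_open hT.
  by case: gauge_sm.
by apply/seteqP; split=> x [[? ?] ?].
Qed.

Lemma submersion_chart_img :
  chart_img C = ((c @` (U `&` chart_dom c)) `*` setT) `*` chart_img d.
Proof.
apply/seteqP; split=> [_ [x [[Ux cx] dx] <-]|
  [[_ v] _] [/= [[x [Ux cx] <-] _] [g dg <-]]].
  by split; [split=> //; exists (pb_proj B x.1)|exists (Phi x.1).2].
exists (Psi (x, g), rho g^-1%g v); rewrite /= (trivVK hT)//= (triv_projV hT)//.
by rewrite repK.
Qed.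

Lemma submersion_chartK x : chart_dom C x -> chart_inv C (C x) = x.
Proof.
case: x => p v [[/= Up cp] dp] /=; rewrite !chartK// repVK.
by rewrite -{1}(triv_fst hT Up) -surjective_pairing (trivK hT).
Qed.

Lemma submersion_chart_maximal : in_maximal_atlas C.
Proof.
have oD := submersion_chart_dom.
have oI : open (chart_img C).
  rewrite submersion_chart_img; apply: open_setX; last by case: hd.
  by apply: chart_cylinder_open; [exact: Ac|exact: hT].
have [cs cis] := smooth_chart (atlas_in_maximal Ac).
have [ds dis] := smooth_chart (atlas_in_maximal Ad).
apply: in_maximal_atlas_smooth => //; first exact: submersion_chartK.
  apply: (@smooth_map_on_pair_model R (P * realify E)%type
    (V * realify E)%type W).
    apply: (@smooth_map_on_pair_model R (P * realify E)%type V (realify E)).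
      apply: (@smooth_map_on_comp R (P * realify E)%type M (model V) _
        (chart_dom c) (fun x => pb_proj B x.1) c) => //.
      - by case: hc.
      - by move=> x [[]].
      - by apply: smooth_map_on_sub pb_proj_fst_smooth.
    by apply: smooth_map_on_sub (gauge_smooth hT) => x [[]].
  apply: (@smooth_map_on_comp R (P * realify E)%type G (model W) _ (chart_dom d)
    gauge d) => //.
  - by case: hd.
  - by move=> x [_].
  - by apply: smooth_map_on_sub gauge_sm => x [[]].
pose T := (V * realify E * W)%type : frechetType R.
have sg : @smooth_map_on R (model T) G (chart_img C) (fun z => chart_inv d z.2).
  apply: (@smooth_map_on_comp R (model T) (model W) G _ (chart_img d) snd)
    => //.
  - by case: hd.
  - by rewrite submersion_chart_img => z [].
  - by apply: smooth_map_on_sub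
      (@smooth_map_linear_model R T W snd (@snd_continuous _ _)).
pose VE := (V * realify E)%type : frechetType R.
have s1 : @smooth_map_on R (model T) (model VE) (chart_img C) fst.
  by apply: smooth_map_on_sub
    (@smooth_map_linear_model R T VE fst (@fst_continuous _ _)).
have s11 : @smooth_map_on R (model T) (model V) (chart_img C) (fun z => z.1.1).
  apply: smooth_map_on_compT s1 _ => //.
  exact: (@smooth_map_linear_model R VE V fst (@fst_continuous _ _)).
have s12 : @smooth_map_on R (model T) (realify E) (chart_img C)
    (fun z => z.1.2).
  apply: smooth_map_on_compT s1 _ => //.
  exact: (@smooth_map_linear_model R VE (realify E) snd (@snd_continuous _ _)).
have sx : @smooth_map_on R (model T) M (chart_img C)
    (fun z => chart_inv c z.1.1).
  apply: (@smooth_map_on_comp R (model T) (model V) M _ (chart_img c)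
    (fun z => z.1.1)) => //.
  - by case: hc.
  - by rewrite submersion_chart_img => z [[[x [Ux cx] <-] _] _]; exists x.
apply: smooth_map_on_pair.
  have [_ [_ oW _ _ [_ _ _ Psis]] _ _] := hT.
  apply: (@smooth_map_on_comp R (model T) (M * G)%type P _ (U `*` setT)
    (fun z => (chart_inv c z.1.1, chart_inv d z.2)) Psi) => //.
    rewrite submersion_chart_img => z [[[x [Ux cx] /= <-] _] _].
    by rewrite chartK.
  exact: smooth_map_on_pair.
apply: (@smooth_map_on_compT R (model T) (G * realify E)%type (realify E) _
  (fun z => ((chart_inv d z.2)^-1%g, z.1.2))) (rep_smooth rho) => //.
apply: smooth_map_on_pair => //.
exact: smooth_map_on_compT sg (@inv_smooth R G).
Qed.

End SubmersionChart.

Lemma assoc_pi_submersion :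
  submersion (assoc_pi : P * realify E -> assoc_total).
Proof.
split; first exact: assoc_pi_smooth.
move=> x; have [V [c [Ac cx]]] := atlas_cover (pb_proj B x.1).
have [U [Phi [Psi [Ux hT]]]] := pb_trivializationP B (pb_proj B x.1).
have [W [d [Ad dx]]] := atlas_cover (Phi x.1).2.
exists (V * realify E)%type, W, (submersion_chart c d U Phi Psi),
  (assoc_chart c U Phi Psi).
split.
- exact: submersion_chart_maximal.
- apply: (@atlas_in_maximal R assoc_total); exact: (AssocAtlas Ac hT).
- by split.
- by move=> _ [y [Uy dy] <-]; rewrite /= assoc_projE.
- by move=> y [[Uy cy] dy]; rewrite /= assoc_projE (fibre_coord_pi hT).
Qed.

(** * Fibrewise operations and the rigged Hilbert space bundle *)

(** A bare choice in each fibre, in general discontinuous: the formulas on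
    classes show that the operations defined through it do not depend on it. *)
Definition base_point (x : M) : P := sval (cid (pb_proj_surj B x)).

Lemma base_pointK x : pb_proj B (base_point x) = x.
Proof. by rewrite /base_point; case: cid. Qed.

Definition base_gauge (p : P) : G :=
  sval (cid (pb_act_transitive (base_pointK (pb_proj B p)))).

Lemma base_gaugeP p : pb_act B (base_point (pb_proj B p)) (base_gauge p) = p.
Proof. by rewrite /base_gauge; case: cid. Qed.

Lemma base_gauge_act p g : base_gauge (pb_act B p g) = (base_gauge p * g)%g.
Proof.
have := base_gaugeP (pb_act B p g); rewrite pb_proj_act.
by rewrite -[in RHS](base_gaugeP p) -pb_actM => /pb_act_free.
Qed.

Lemma base_gauge_point x : base_gauge (base_point x) = 1%g.
Proof.
have := base_gaugeP (base_point x); rewrite base_pointK.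
by rewrite -[in RHS](pb_act1 B (base_point x)) => /pb_act_free.
Qed.

Definition coord (e : assoc_total) : E := fibre_coord base_gauge e.

Definition of_coord (x : M) (v : E) : assoc_total := cls (base_point x) v.

Lemma coord_class p v : coord (cls p v) = rho (base_gauge p) v.
Proof. by apply: fibre_coordE => g; exact: base_gauge_act. Qed.

Lemma of_coordK x v : coord (of_coord x v) = v.
Proof. by rewrite coord_class base_gauge_point rep1. Qed.

Lemma proj_of_coord x v : assoc_proj (of_coord x v) = x.
Proof. by rewrite assoc_projE base_pointK. Qed.

Lemma class_of_coord p v :
  cls p v = of_coord (pb_proj B p) (rho (base_gauge p) v).
Proof. by rewrite /of_coord -assoc_class_act base_gaugeP. Qed.

Lemma coordK e : of_coord (assoc_proj e) (coord e) = e.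
Proof.
rewrite -[e]assoc_reprK /assoc_pi; case: (assoc_repr e) => p v /=.
by rewrite assoc_projE coord_class -class_of_coord.
Qed.

Lemma repZD g a v w : rho g (a *: v + w) = a *: rho g v + rho g w.
Proof. exact: im_linear (rep_morphism rho g) a v w. Qed.

Lemma repD g v w : rho g (v + w) = rho g v + rho g w.
Proof. by rewrite -[v]scale1r repZD !scale1r. Qed.

Lemma rep0 g : rho g 0 = 0.
Proof. by apply: (addrI (rho g 0)); rewrite -repD !addr0. Qed.

Lemma repZ g a v : rho g (a *: v) = a *: rho g v.
Proof. by rewrite -[a *: v]addr0 repZD rep0 addr0. Qed.

Definition assoc_zero x : assoc_total := of_coord x 0.
Definition assoc_add (e f : assoc_total) : assoc_total :=
  of_coord (assoc_proj e) (coord e + coord f).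
Definition assoc_scale (a : R[i]) (e : assoc_total) : assoc_total :=
  of_coord (assoc_proj e) (a *: coord e).
Definition assoc_metric (e f : assoc_total) : R[i] :=
  rh_inner E (coord e) (coord f).

Lemma assoc_add_class p v w :
  assoc_add (cls p v) (cls p w) = cls p (v + w).
Proof.
by rewrite /assoc_add assoc_projE !coord_class -repD -class_of_coord.
Qed.

Lemma assoc_scale_class a p v : assoc_scale a (cls p v) = cls p (a *: v).
Proof.
by rewrite /assoc_scale assoc_projE coord_class -repZ -class_of_coord.
Qed.

Lemma assoc_metric_class p v w :
  assoc_metric (cls p v) (cls p w) = rh_inner E v w.
Proof.
by rewrite /assoc_metric !coord_class (im_isometric (rep_morphism rho _)).
Qed.

Lemma smooth_from_assoc (N : frechetManifoldType R) (O : set M)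
    (h : assoc_total -> N) (h' : P * realify E -> N) : open O ->
  (forall p v, O (pb_proj B p) -> h (cls p v) = h' (p, v)) ->
  smooth_map_on (base @^-1` O) h' ->
  @smooth_map_on R assoc_total N (assoc_proj @^-1` O) h.
Proof.
move=> oO hh' sh'.
apply: (smooth_map_on_descend assoc_pi_submersion).
- exact: assoc_proj_open.
- by move=> e _; exists (assoc_repr e); exact: assoc_reprK.
rewrite assoc_pi_projE; apply: smooth_map_on_ext sh'; first exact: open_pb_fst.
by move=> [p v] /= Op; rewrite hh'.
Qed.

Lemma assoc_proj_smooth : @smooth_map R assoc_total M assoc_proj.
Proof.
apply: (@smooth_from_assoc M setT _ (fun x => pb_proj B x.1)).
- exact: openT.
- by move=> p v _; rewrite assoc_projE.
- exact: pb_proj_fst_smooth.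
Qed.

Section Trivialization.
Variables (U : set M) (Phi : P -> M * G) (Psi : M * G -> P).
Hypothesis hT : pb_trivialization B U Phi Psi.

Definition assoc_triv (e : assoc_total) : M * realify E :=
  (assoc_proj e, fibre_coord (fun p => (Phi p).2) e).
Definition assoc_triv_inv (z : M * realify E) : assoc_total :=
  cls (Psi (z.1, 1%g)) z.2.

(** In a trivialisation the coordinate with respect to the base point is changed
    by the action of a single group element depending on [x] only, which is a
    linear isometry. *)
Lemma assoc_triv_of_coord x v : U x ->
  (assoc_triv (of_coord x v)).2 = rho (Phi (base_point x)).2 v.
Proof.
by move=> Ux; rewrite /assoc_triv /= (fibre_coord_pi hT) ?base_pointK.
Qed.

Lemma assoc_triv_coord e : U (assoc_proj e) ->
  (assoc_triv e).2 = rho (Phi (base_point (assoc_proj e))).2 (coord e).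
Proof. by move=> Ue; rewrite -{1}[e]coordK assoc_triv_of_coord. Qed.

Lemma assoc_triv_diffeo :
  @diffeo_on R assoc_total (M * realify E)%type (assoc_proj @^-1` U)
    (U `*` setT) assoc_triv assoc_triv_inv.
Proof.
have oU := triv_open hT; have oUT : open (U `*` (setT : set (realify E))).
  by apply: open_setX => //; exact: openT.
split=> //.
- exact: assoc_proj_open.
- by move=> _ [e Ue <-].
- by move=> _ [[x v] [/= Ux _] <-]; rewrite /= (assoc_proj_triv hT).
split.
- by move=> e; rewrite inE => Ue; exact: (fibre_coordK hT).
- move=> [x v] /set_mem[/= Ux _]; rewrite /assoc_triv /assoc_triv_inv /=.
  by rewrite (assoc_proj_triv hT)// (fibre_coord_triv hT)// rep1.
- apply: (@smooth_from_assoc (M * realify E)%type U assoc_triv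
    (fun x => (pb_proj B x.1, rho (Phi x.1).2 x.2))) => //.
    by move=> p v Up; rewrite /assoc_triv assoc_projE (fibre_coord_pi hT).
  exact: (triv_coord_smooth hT).
exact: (smooth_map_on_compT oUT (triv_section_smooth hT) assoc_pi_smooth).
Qed.

Lemma assoc_triv_bundle : @bundle_trivialization R E M assoc_total
  assoc_proj assoc_add assoc_scale U assoc_triv assoc_triv_inv.
Proof.
split.
- exact: triv_open hT.
- exact: assoc_triv_diffeo.
- by [].
- move=> e f Ue ef; have Uf : U (assoc_proj f) by rewrite -ef.
  by rewrite assoc_triv_of_coord// !assoc_triv_coord// repD -ef.
- by move=> a e Ue; rewrite assoc_triv_of_coord// assoc_triv_coord// repZ.
Qed.

Lemma assoc_triv_isometry e f :
  U (assoc_proj e) -> assoc_proj e = assoc_proj f ->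
  rh_inner E (assoc_triv e).2 (assoc_triv f).2 = assoc_metric e f.
Proof.
move=> Ue ef; have Uf : U (assoc_proj f) by rewrite -ef.
by rewrite !assoc_triv_coord// -ef (im_isometric (rep_morphism rho _)).
Qed.

End Trivialization.

Definition assoc_vectorBundle : vectorBundle E M assoc_total.
Proof.
apply: (@VectorBundle R E M assoc_total _ assoc_zero assoc_add assoc_scale
  assoc_proj_smooth).
- by move=> x; rewrite proj_of_coord.
- by move=> e f _; rewrite proj_of_coord.
- by move=> a e; rewrite proj_of_coord.
- by move=> e f h _ _; rewrite /assoc_add !of_coordK !proj_of_coord addrA.
- by move=> e f ef; rewrite /assoc_add ef addrC.
- by move=> e; rewrite /assoc_add of_coordK proj_of_coord add0r coordK.
- by move=> e; rewrite /assoc_add of_coordK proj_of_coord scaleN1r addNr.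
- by move=> e; rewrite /assoc_scale scale1r coordK.
- by move=> a b e; rewrite /assoc_scale of_coordK proj_of_coord scalerA.
- move=> a e f _; rewrite /assoc_scale /assoc_add !of_coordK !proj_of_coord.
  by rewrite scalerDr.
- move=> a b e; rewrite /assoc_scale /assoc_add !of_coordK !proj_of_coord.
  by rewrite scalerDl.
move=> x; have [U [Phi [Psi [Ux hT]]]] := pb_trivializationP B x.
exists U, (assoc_triv Phi), (assoc_triv_inv Psi); split=> //.
exact: assoc_triv_bundle.
Defined.

Definition assoc_riggedHilbertBundle : riggedHilbertBundle E M assoc_total.
Proof.
apply: (@RiggedHilbertBundle R E M assoc_total assoc_vectorBundle assoc_metric)
  => /=.
- by move=> a e f h _ _; rewrite /assoc_metric !of_coordK linearPl.
- by move=> e f _; rewrite /assoc_metric hermC /= expr0 mul1r.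
- move=> e e0; apply: neq0_dnorm_gt0; apply/eqP => c0; apply: e0.
  by rewrite -[LHS]coordK c0.
move=> x; have [U [Phi [Psi [Ux hT]]]] := pb_trivializationP B x.
exists U, (assoc_triv Phi), (assoc_triv_inv Psi); split=> //.
  exact: assoc_triv_bundle.
exact: assoc_triv_isometry hT.
Defined.

End AssocBundle.

Unset Implicit Arguments.
Theorem proposition2p1p15 (R : realType) (G : frechetLieGroupType R)
    (M P : frechetManifoldType R) (B : principalBundle G M P)
    (E : riggedHilbertType R) (rho : smoothRepresentation G E) :
  exists X : frechet_structure R (assoc_bundle B rho),
    [/\ assoc_structure X,
        forall Y : frechet_structure R (assoc_bundle B rho),
          assoc_structure Y -> same_structure X Y &
        exists H : riggedHilbertBundle E M (with_structure X),
          [/\ forall (p : P) (v : E),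
                vb_proj H (assoc_class B rho p v) = pb_proj B p,
              forall (p : P) (v w : E),
                vb_add H (assoc_class B rho p v) (assoc_class B rho p w) =
                assoc_class B rho p (v + w),
              forall (a : R[i]) (p : P) (v : E),
                vb_scale H a (assoc_class B rho p v) =
                assoc_class B rho p (a *: v) &
              forall (p : P) (v w : E),
                rhb_metric H (assoc_class B rho p v) (assoc_class B rho p w) =
                rh_inner E v w]].
Proof.
have sub := assoc_pi_submersion B rho.
exists (FrechetManifold.class (assoc_total B rho)); split.
- exact: sub.
- move=> Y sY; apply: submersion_same_structure (sY) => //.
  by move=> e; exists (assoc_repr e); exact: assoc_reprK.
exists (assoc_riggedHilbertBundle B rho); split.
- exact: assoc_projE.
- exact: assoc_add_class.
- exact: assoc_scale_class.
- exact: assoc_metric_class.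
Qed.
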